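(* Let $n\ge2$, $p\in(1,\infty)$, and let $\Omega\subset\mathbb{R}^n$ be a convex domain with $C^2$ boundary, $\delta(\mathbf{x})=\operatorname{dist}(\mathbf{x},\mathbb{R}^n\setminus\Omega)$, whose ridge $\mathcal{R}(\Omega)$ is closed relative to $\Omega$. Suppose that $\mathcal{R}(\Omega)$ is the intersection of a decreasing family (as $\epsilon\downarrow0$) of open neighbourhoods $\{S_\epsilon:\epsilon>0\}$ of $\mathcal{R}(\Omega)$ in $\Omega$ with smooth boundaries such that, with $\eta_\epsilon(\mathbf{x})$ denoting the unit inward normal (pointing into $S_\epsilon$) at $\mathbf{x}\in\partial S_\epsilon$, $$(\nabla\delta\cdot\eta_\epsilon)(\mathbf{x})\ge0,\qquad \mathbf{x}\in\partial S_\epsilon,$$ for all sufficiently small $\epsilon$, and that $\frac{p-1}{p}\ge\delta(\mathbf{x})\Delta\delta(\mathbf{x})$ for $\mathbf{x}\in\Omega\setminus\mathcal{R}(\Omega)$. Then for every $f\in C_0^\infty(\Omega)$, $$\int_\Omega|\nabla\delta\cdot\nabla f|^p\,d\mathbf{x}\ \ge\ \left(\frac{p-1}{p}\right)^p\int_\Omega\left\{1+\frac{p\,\delta\,|\tilde\kappa|}{p-1}\right\}\frac{|f|^p}{\delta^p}\,d\mathbf{x},$$ where $\tilde\kappa(\mathbf{x})=\sum_{i=1}^{n-1}\frac{\kappa_i}{1+\delta(\mathbf{x})\kappa_i}$ and $\kappa_1,\dots,\kappa_{n-1}$ are the principal curvatures of $\partial\Omega$ at the near point $N(\mathbf{x})$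 of $\mathbf{x}\in\Omega\setminus\mathcal{R}(\Omega)$.
   Context: A domain is an open connected set. $\partial\Omega\in C^2$ means that locally, after a rotation of coordinates, $\partial\Omega$ is the graph of a $C^2$ function of $n-1$ variables. For $\mathbf{x}\in\Omega$ let $N(\mathbf{x})=\{\mathbf{y}\in\partial\Omega: |\mathbf{y}-\mathbf{x}|=\delta(\mathbf{x})\}$ be the set of near points of $\mathbf{x}$; when $N(\mathbf{x})=\{\mathbf{y}\}$ one writes $N(\mathbf{x})=\mathbf{y}$. The skeleton is $\mathcal{S}(\Omega)=\{\mathbf{x}\in\Omega: \operatorname{card}N(\mathbf{x})>1\}$. For $\mathbf{x}\in\Omega$ and $\mathbf{y}\in N(\mathbf{x})$ put $\lambda=\sup\{t\in(0,\infty): \mathbf{y}\in N(\mathbf{y}+t[\mathbf{x}-\mathbf{y}])\}$; when $\lambda<\infty$, $\mathbf{y}+\lambda[\mathbf{x}-\mathbf{y}]$ is the ridge point of $\mathbf{x}$, and the ridge $\mathcal{R}(\Omega)$ is the set of all ridge points. One has $\mathcal{S}(\Omega)\subseteq\mathcal{R}(\Omega)\subseteq\overline{\mathcal{S}(\Omega)}$, so each $\mathbf{x}\in\Omega\setminus\mathcal{R}(\Omega)$ has a unique near point. Standing assumption: $\mathcal{R}(\Omega)$ is closed relative to $\Omega$. For such $\Omega$ the ridge has Lebesgue measure zero, so $\tilde\kappa$ is defined almost everywhere in $\Omega$. Sign convention for principal curvatures: if $\mathbf{n}$ is the unit normal to $\partial\Omega$ pointing into $\Omega$ and $\mathbf{v}_i$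 are orthonormal principal directions, then $\kappa_i$ is defined by $\partial_{\mathbf{v}_i}\mathbf{n}=\kappa_i\mathbf{v}_i$ (so the $\kappa_i$ are non-positive when $\Omega$ is convex). *)

(* Defs.v *)
From HB Require Import structures.
From mathcomp Require Import all_boot all_order all_algebra.
From mathcomp Require Import all_classical all_reals all_analysis.
Import Order.TTheory GRing.Theory Num.Theory.
Import numFieldNormedType.Exports.

Set Implicit Arguments.
Unset Strict Implicit.
Unset Printing Implicit Defensive.

Local Open Scope classical_set_scope.
Local Open Scope ring_scope.

(* The library provides product sigma-algebras on tuples but no Lebesgue
   measure on them: it is built here by iterating the binary product. *)
Section lebesgue_measure_Rn.
Context {R : realType}.
Local Notation RT := (measurableTypeR R).

Definition tcons n (z : n.-tuple RT * RT) : n.+1.-tuple RT :=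
  [tuple of z.2 :: z.1].

Lemma measurable_tcons n : measurable_fun [set: _] (@tcons n).
Proof. exact: (@measurable_cons _ _ _ _ snd n fst). Qed.

Definition lebesgue_tcons n (mu : {measure set (n.-tuple RT) -> \bar R}) :
    set (n.+1.-tuple RT) -> \bar R :=
  pushforward (mu \x (@lebesgue_measure R))%E (@tcons n).

HB.instance Definition _ n (mu : {measure set (n.-tuple RT) -> \bar R}) :=
  Measure.copy (lebesgue_tcons mu)
    (measure_function_pushforward__canonical__measure_function_Measure
       (mu \x (@lebesgue_measure R))%E (@measurable_tcons n)).

Fixpoint lebesgue_Rn n : {measure set (n.-tuple RT) -> \bar R} :=
  if n is m.+1 then lebesgue_tcons (lebesgue_Rn m) else \d_ [tuple].

Definition row_of_tuple n (t : n.-tuple RT) : 'rV[R]_n := \row_i tnth t i.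

(* [\int_A g dx] for a nonnegative [g]. *)
Definition integral_Rn n (A : set 'rV[R]_n) (g : 'rV[R]_n -> R) : \bar R :=
  \int[lebesgue_Rn n]_(t in @row_of_tuple n @^-1` A) (g (row_of_tuple t))%:E.

End lebesgue_measure_Rn.

Section geometry.
Context {R : realType}.

Section any_dimension.
Variable n : nat.
Local Notation E := 'rV[R]_n.
Implicit Types (A U M Omega : set E) (x y v w eta : E).

(* The library's norm on ['rV[R]_n] is the sup norm (same topology), hence the
   separate Euclidean norm. *)
Definition dotp x y : R := \sum_i x 0 i * y 0 i.
Definition enorm x : R := Num.sqrt (dotp x x).

Definition bdry A : set E := closure A `\` A°.

Definition is_domain A : Prop := open A /\ connected A.

Definition partial (i : 'I_n) (g : E -> R) : E -> R := 'D_(delta_mx 0 i) g.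
Definition grad (g : E -> R) x : E := \row_i partial i g x.
Definition laplacian (g : E -> R) x : R := \sum_i partial i (partial i g) x.

(* Meant for [U] open. *)
Fixpoint Ck (k : nat) U (g : E -> R) : Prop :=
  (forall x, U x -> {for x, continuous g}) /\
  (if k is k'.+1 then
     forall i : 'I_n,
       (forall x, U x -> derivable g x (delta_mx 0 i)) /\ Ck k' U (partial i g)
   else True).

Definition smooth_compact_support Omega (f : E -> R) : Prop :=
  [/\ forall k, Ck k [set: E] f,
      compact (closure [set x | f x != 0]) &
      closure [set x | f x != 0] `<=` Omega].

Definition dist_set A x : R := inf [set enorm (x - y) | y in A].

Definition delta Omega x : R := dist_set (~` Omega) x.

Definition near_points Omega x : set E :=
  [set y | bdry Omega y /\ enorm (y - x) = delta Omega x].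

(* Off the ridge [near_points Omega x] is a singleton; on the ridge, a null
   set, the choice is arbitrary. *)
Definition near_point Omega x : E := get (near_points Omega x).

Definition ridge_factor Omega x y : \bar R :=
  ereal_sup [set t%:E | t in
    [set t : R | 0 < t /\ near_points Omega (y + t *: (x - y)) y]].

Definition ridge Omega : set E :=
  [set r | exists x y, [/\ Omega x, near_points Omega x y,
    (ridge_factor Omega x y < +oo)%E &
    r = y + fine (ridge_factor Omega x y) *: (x - y)]].

Definition closed_relative_to Omega A : Prop :=
  exists2 C, closed C & A = Omega `&` C.

(* Tangent vectors are the velocities of curves drawn on [M]. *)
Definition curve_on M x v (c : R -> E) : Prop :=
  [/\ c 0 = x, (\forall t \near 0, M (c t)) & is_derive (0 : R^o) 1 c v].

Definition tangent M x v : Prop := exists c, curve_on M x v c.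

Definition inward_normal A x eta : Prop :=
  [/\ enorm eta = 1,
      forall v, tangent (bdry A) x v -> dotp eta v = 0 &
      \forall t \near 0^'+, A (x + t *: eta)].

Definition normal_field A x : E := get (inward_normal A x).

(* [\partial_v F = w] for a vector field [F] along the hypersurface [M]. *)
Definition derive_along M (F : E -> E) x v w : Prop :=
  tangent M x v /\ forall c, curve_on M x v c -> is_derive (0 : R^o) 1 (F \o c) w.

Definition principal_curvatures A y (kappa : 'I_n.-1 -> R) : Prop :=
  exists v : 'I_n.-1 -> E,
    (forall i j, dotp (v i) (v j) = (i == j)%:R) /\
    (forall i, derive_along (bdry A) (normal_field A) y (v i)
                 (kappa i *: v i)).

Definition kappa_tilde Omega (kappa : E -> 'I_n.-1 -> R) x : R :=
  \sum_(i < n.-1) kappa (near_point Omega x) i /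
                  (1 + delta Omega x * kappa (near_point Omega x) i).

End any_dimension.

(* Near each of its points the boundary is, in the rotated coordinates
   [z *m Q], the graph of the [i]-th coordinate as a function [phi] of the
   other ones, which [col' i] extracts; [C V phi] is the regularity demanded of
   [phi] on the open set [V]. *)
Definition graph_boundary n
    (C : set 'rV[R]_n.-1 -> ('rV[R]_n.-1 -> R) -> Prop) (A : set 'rV[R]_n) :=
  forall y, bdry A y ->
  exists (Q : 'M[R]_n) (i : 'I_n) (U : set 'rV[R]_n) (V : set 'rV[R]_n.-1)
         (phi : 'rV[R]_n.-1 -> R),
    [/\ Q *m Q^T = 1%:M, \det Q = 1, open_nbhs y U, open V & C V phi] /\
    forall z, U z -> V (col' i (z *m Q)) /\
      (bdry A z <-> (z *m Q) 0 i = phi (col' i (z *m Q))).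

Definition Ck_boundary n (k : nat) (A : set 'rV[R]_n) : Prop :=
  graph_boundary (Ck k) A.

Definition smooth_boundary n (A : set 'rV[R]_n) : Prop :=
  graph_boundary (fun V phi => forall k, Ck k V phi) A.

End geometry.

(* Main.v *)
Require Import Defs.
From HB Require Import structures.
From mathcomp Require Import all_boot all_order all_algebra.
From mathcomp Require Import all_classical all_reals all_analysis.
From mathcomp Require Import ring lra.
Import Order.TTheory GRing.Theory Num.Theory.
Import numFieldNormedType.Exports.
Import measurable_realfun.

(* For convex [Omega] the distance [d] to the complement is concave on [Omega], so the
   distributional Laplacian of [-d] is a nonnegative measure, whose singular part on the
   ridge can be dropped.  With [psi = |f|^p d^(1-p)], a discrete integration by parts gives
     int psi (- Delta_h d) = int (D_h psi) . (D_h d),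
   where [- Delta_h d >= 0] on the support of [f].  Letting [h -> 0], Fatou's lemma on the
   left and dominated convergence on the right yield
     int psi L <= int (grad psi) . (grad d),    L = liminf (- Delta_h d).
   In particular [L < +oo] almost everywhere on [f != 0].  At such a point, [grad d] exists
   and is a unit vector pointing away from the near point [y]; moving [y] along the C^2
   boundary, with tangential speed [A_i] in the principal direction [v_i], bounds [d] from
   above to second order and gives, for every [A],
     L >= - sum_i ((1 - A_i)^2 / d + kappa_i A_i^2).
   Finiteness of [L] forces [1 + d kappa_i > 0], and [A_i = 1 / (1 + d kappa_i)] gives
   [L >= |kappa_tilde|]; the null set [L = +oo] plays the role of the ridge.
   Finally [(grad psi) . (grad d)] is bounded through Young's inequality applied pointwise
   to [|grad d . grad f|] and [(|f| / d)^(p-1)]. *)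

Set Implicit Arguments.
Unset Strict Implicit.
Unset Printing Implicit Defensive.

Local Open Scope classical_set_scope.
Local Open Scope ring_scope.

(** * Lebesgue measure on tuples *)

Section lebesgue_Rn_theory.
Context {R : realType}.
Local Notation RT := (measurableTypeR R).

(** The obstacle is regularity: [delta] is only concave on [Omega] and Lipschitz, near points are
    selected by choice, and measurability of [grad delta] or [kappa_tilde] is nowhere established.
    All limits are therefore taken on continuous difference quotients along explicit steps
    [r / (k + 1)], for which integration by parts is just translation invariance of the measure. The
    two integrands of the theorem meet measurable functions only at the end, outside a null set.
    Differentiability almost everywhere is a by-product of [L < +oo]. The near point bounds [d] from
    above by a quadratic; second differences bounded along some steps tending to 0 turn this,
    through concavity, into a matching bound from below. No second-order regularity of [d] is used:
    a lower bound on [L] only needs [d] bounded from above, so one moving boundary point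
    suffices. *)

Lemma measurable_row_of_tuple_open n (U : set 'rV[R]_n) :
  open U -> measurable (@row_of_tuple R n @^-1` U).
Proof.
move=> oU.
(* Balls of the sup norm are boxes, so an open set is a countable union of boxes with rational
   centre and radius [1 / (k + 1)]; [F] replaces by [set0] the boxes not contained in [U]. *)
pose box (p : n.-tuple rat * nat) : set (n.-tuple RT) :=
  \bigcap_(i in [set: 'I_n])
    (fun t => tnth t i) @^-1` [set r | `|r - ratr (tnth p.1 i)| < p.2.+1%:R^-1].
pose F p := if `[< box p `<=` row_of_tuple (n:=n) @^-1` U >] then box p else set0.
have mbox p : measurable (box p).
  apply: fin_bigcap_measurable => // i _.
  rewrite -[X in measurable X]setTI; apply: measurable_tnth => //.
  set c := ratr _; set e := _^-1.
  rewrite (_ : [set r | _] = `]c - e, c + e[%classic).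
    exact: measurable_itv.
  by apply/seteqP; split => r /=; rewrite in_itv/= ltr_distl.
have mF p : measurable (F p) by rewrite /F; case: ifP.
rewrite (_ : _ @^-1` U = \bigcup_p F p).
  exact: countable_bigcupT_measurable.
apply/seteqP; split=> [t /= Ut|t [p _]]; last first.
  by rewrite /F; case: ifPn => //= /asboolP; apply.
have /nbhs_ballP[e /= e0 eU] := open_nbhs_nbhs (conj oU Ut).
have [k /= ke] : exists k, k.+1%:R^-1 < e / 2 :> R.
  have [k _ /(_ k)] := near_infty_natSinv_lt (PosNum (divr_gt0 e0 (ltr0n _ 2))).
  by move=> /(_ (leqnn _)); exists k.
have k0 : (0 : R) < k.+1%:R^-1 by rewrite invr_gt0.
have /choice[q hq] : forall i : 'I_n, exists q : rat,
    `|tnth t i - ratr q| < k.+1%:R^-1.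
  move=> i; have : tnth t i - k.+1%:R^-1 < tnth t i + k.+1%:R^-1 :> R.
    by rewrite ltrBlDr -addrA ltrDl addr_gt0.
  move=> /rat_in_itvoo[q]; rewrite in_itv/= => qt; exists q.
  by rewrite distrC ltr_distl.
exists ([tuple q i | i < n], k) => //; rewrite /F.
have tbox : box ([tuple q i | i < n], k) t.
  by move=> i _ /=; rewrite tnth_mktuple.
case: ifPn => // /negP; apply: contra_notP => _; apply/asboolP => s sbox /=.
apply: eU; split=> // i j; rewrite !mxE /ball/=.
have := tbox j I; have := sbox j I; rewrite /= tnth_mktuple => h1 h2.
rewrite -(subrKA (ratr (q j))) (le_lt_trans (ler_normD _ _))//.
rewrite [e]splitr ltrD// (lt_trans _ ke)// distrC.
by [].
Qed.

Lemma measurable_continuous_Rn n (G : 'rV[R]_n -> R) : continuous G ->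
  measurable_fun [set: n.-tuple RT] (G \o @row_of_tuple R n).
Proof.
move=> /continuousP cG; apply: (measurability _ (RGenOpens.measurableE R)).
move=> _ [_ [a [b ->] <-]]; rewrite setTI comp_preimage.
by apply: measurable_row_of_tuple_open; apply: cG; exact: interval_open.
Qed.

Lemma integral_lebesgue_RnS n
  (g : n.+1.-tuple RT -> \bar R) :
  measurable_fun [set: n.+1.-tuple RT] g -> (forall t, 0 <= g t)%E ->
  (\int[lebesgue_Rn n.+1]_t g t =
   \int[(lebesgue_Rn n \x @lebesgue_measure R)%E]_z g (tcons z))%E.
Proof.
move=> mg g0.
by rewrite ge0_integral_pushforward//; [exact: measurable_tcons].
Qed.

Definition cube n (N : R) : set (n.-tuple RT) :=
  [set t | forall i, tnth t i \in `[- N, N]].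

Lemma cubeS n (N : R) :
  @tcons R n @^-1` (@cube n.+1 N) = @cube n N `*` `[- N, N]%classic.
Proof.
apply/seteqP; split=> -[t r] /=.
  move=> h; split; last exact: (h ord0).
  by move=> i; have := h (lift ord0 i); rewrite tnthS.
by move=> [ht hr] i; case: (unliftP ord0 i) => [j ->|->]; rewrite ?tnthS.
Qed.

Lemma measurable_cube n N : measurable (@cube n N).
Proof.
rewrite (_ : @cube n N =
    \bigcap_(i in [set: 'I_n]) (fun t => tnth t i) @^-1` `[- N, N]%classic).
  apply: fin_bigcap_measurable => // i _.
  by rewrite -[X in measurable X]setTI; apply: measurable_tnth.
by apply/seteqP; split => t h i; [move=> _; exact: h|exact: (h i I)].
Qed.

Lemma lebesgue_Rn_cube n N : (lebesgue_Rn n (@cube n N) < +oo :> \bar R)%E.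
Proof.
elim: n => [|n IH].
  by rewrite /= diracE; case: (_ \in _); rewrite ltry.
rewrite -[X in (X < _)%E]/((lebesgue_Rn n \x @lebesgue_measure R)%E
  (@tcons R n @^-1` @cube n.+1 N)) cubeS product_measure1E//; last first.
  exact: measurable_cube.
rewrite lte_mul_pinfty ?ge0_fin_numE//.
rewrite /= lebesgue_measure_itv/=; by case: ifP => _; rewrite ?ltry// -EFinD ltry.
Qed.

Lemma bigcup_cube n : \bigcup_i @cube n i%:R = [set: n.-tuple RT].
Proof.
apply/seteqP; split => // t _.
pose m := \sum_(i < n) `|tnth t i|.
exists (Num.truncn m).+1 => // i.
have : `|tnth t i| <= m.
  by rewrite /m (bigD1 i)//= lerDl sumr_ge0.
have := truncnS_gt m; rewrite in_itv/= -ler_norml => /ltW h1 h2.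
exact: le_trans h2 h1.
Qed.

Lemma lebesgue_Rn_sigma_finite n : sigma_finite setT (@lebesgue_Rn R n).
Proof.
exists (fun i => @cube n i%:R); first by rewrite bigcup_cube.
by move=> i; split; [exact: measurable_cube|exact: lebesgue_Rn_cube].
Qed.

(* A function-typed alias, on which a sigma-finite instance can be declared. *)
Let muf n : set (n.-tuple RT) -> \bar R := @lebesgue_Rn R n.

HB.instance Definition _ n := Measure.copy (@muf n) (@lebesgue_Rn R n).
HB.instance Definition _ n :=
  @Measure_isSigmaFinite.Build _ _ _ (@muf n) (@lebesgue_Rn_sigma_finite n).

Definition tshift n (i : 'I_n) (h : R) (t : n.-tuple RT) : n.-tuple RT :=
  [tuple tnth t j + h *+ (j == i) | j < n].

Lemma row_of_tuple_tshift n (i : 'I_n) h t :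
  row_of_tuple (tshift i h t) = row_of_tuple t + h *: delta_mx 0 i.
Proof.
by apply/rowP => j; rewrite !mxE tnth_mktuple /= mulr_natr.
Qed.

Lemma tshift0 n h (t : n.-tuple RT) r :
  tshift ord0 h (tcons (t, r)) = tcons (t, r + h).
Proof.
apply: eq_from_tnth => j; rewrite tnth_mktuple.
by case: (unliftP ord0 j) => [k ->|->]; rewrite ?tnthS//= addr0.
Qed.

Lemma tshiftS n (i : 'I_n) h (t : n.-tuple RT) r :
  tshift (lift ord0 i) h (tcons (t, r)) = tcons (tshift i h t, r).
Proof.
apply: eq_from_tnth => j; rewrite tnth_mktuple.
case: (unliftP ord0 j) => [k ->|->]; rewrite ?tnthS//= ?addr0//.
by rewrite tnth_mktuple (inj_eq lift_inj).
Qed.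

Lemma measurable_tshift n (i : 'I_n) h : measurable_fun setT (tshift i h).
Proof.
apply/measurable_fun_tnthP => j.
rewrite (_ : _ \o _ = (fun r : RT => r + h *+ (j == i)) \o (fun t => tnth t j)).
  apply: measurableT_comp; last exact: measurable_tnth.
  exact: measurable_funD.
by apply/funext => t /=; rewrite tnth_mktuple.
Qed.

(** The pushforward under translation agrees with Lebesgue measure on half-open intervals, and
    uniqueness of the extension does the rest. *)
Lemma ge0_integral_shift1 (h : R) (g : RT -> \bar R) :
  measurable_fun [set: RT] g -> (forall r, 0 <= g r)%E ->
  (\int[@lebesgue_measure R]_r g (r + h)%R = \int[@lebesgue_measure R]_r g r)%E.
Proof.
move=> mg g0.
have mphi : measurable_fun setT (fun r : RT => r + h : RT) by exact: measurable_funD.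
transitivity (\int[pushforward (@lebesgue_measure R) (fun r : RT => (r + h)%R : RT)]_r g r)%E.
  by rewrite ge0_integral_pushforward.
apply: eq_measure_integral => A mA _.
apply/esym/lebesgue_measure_unique => //.
move=> _ [[a b] _ <-]/=.
rewrite /pushforward (_ : _ @^-1` _ = `]a - h, b - h]%classic); last first.
  by apply/seteqP; split => r /=; rewrite !in_itv/= ltrBlDr lerBrDr.
rewrite !lebesgue_measure_itv/= !lte_fin ltrD2r.
by case: ifP => // _; rewrite -!EFinD; congr EFin; ring.
Qed.

(** Induction on the dimension through Tonelli: a shift of coordinate [ord0] acts in the inner
    one-dimensional integral, a shift of any other coordinate in the outer one. *)
Lemma ge0_integral_tshift n (i : 'I_n) (h : R) (g : n.-tuple RT -> \bar R) :
  measurable_fun [set: n.-tuple RT] g -> (forall t, 0 <= g t)%E ->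
  (\int[lebesgue_Rn n]_t g (tshift i h t) = \int[lebesgue_Rn n]_t g t)%E.
Proof.
elim: n i g => [[]//|n IH] i g mg g0.
rewrite integral_lebesgue_RnS//; last first.
  by apply: measurableT_comp => //; exact: measurable_tshift.
rewrite integral_lebesgue_RnS//.
have mgt : measurable_fun setT (fun z : n.-tuple RT * RT => g (tcons z)).
  by apply: measurableT_comp => //; exact: measurable_tcons.
rewrite [RHS](fubini_tonelli1 (m1 := @muf n))//.
rewrite [LHS](fubini_tonelli1 (m1 := @muf n))//; last first.
  apply: measurableT_comp => //.
  by apply: measurableT_comp; [exact: measurable_tshift|exact: measurable_tcons].
have [j ->|->] := unliftP ord0 i.
  rewrite -[RHS](IH j); last 2 first.
  - exact: (measurable_fun_fubini_tonelli_F _ mgt (fun z => g0 _)).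
  - by move=> t; apply: integral_ge0.
  apply: eq_integral => t _; apply: eq_integral => r _.
  by rewrite tshiftS.
apply: eq_integral => t _; rewrite /fubini_F.
under eq_integral do rewrite tshift0.
rewrite (ge0_integral_shift1 h (g := fun r => g (tcons (t, r))))//.
apply: measurableT_comp => //.
by apply: measurableT_comp => //; exact: measurable_tcons.
Qed.

End lebesgue_Rn_theory.

(** * Discrete integration by parts *)

Lemma cvg_sumr {R : realType} {T : Type} (F : set_system T) {FF : Filter F}
    (I : finType) (f : I -> T -> R) (a : I -> R) :
  (forall i, f i x @[x --> F] --> a i) ->
  \sum_i f i x @[x --> F] --> \sum_i a i.
Proof. by move=> fa; apply: cvg_big => //; exact: add_continuous. Qed.

Section integration_by_parts.
Context {R : realType}.
Local Notation RT := (measurableTypeR R).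
Variable n : nat.
Local Notation E := 'rV[R]_n.
Local Notation mu := (@lebesgue_Rn R n).
Local Notation rot := (@row_of_tuple R n).
Local Notation e i := (delta_mx 0 i : E).

Lemma integral_tshift (i : 'I_n) (h : R) (g : n.-tuple RT -> \bar R) :
  measurable_fun [set: n.-tuple RT] g ->
  (\int[mu]_t g (tshift i h t) = \int[mu]_t g t)%E.
Proof.
move=> mg; rewrite integralE [RHS]integralE.
congr (_ - _)%E.
  have <- := @ge0_integral_tshift R n i h _ (measurable_funepos mg) (fun t => funepos_ge0 g t).
  by apply: eq_integral => t _; rewrite !funeposE.
have <- := @ge0_integral_tshift R n i h _ (measurable_funeneg mg) (fun t => funeneg_ge0 g t).
  by apply: eq_integral => t _; rewrite !funenegE.
Qed.

Lemma integrable_tshift (i : 'I_n) (h : R) (g : n.-tuple RT -> \bar R) :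
  mu.-integrable setT g -> mu.-integrable setT (g \o tshift i h).
Proof.
move=> /integrableP[mg ig]; apply/integrableP; split.
  by apply: measurableT_comp => //; exact: measurable_tshift.
have mag : measurable_fun [set: n.-tuple RT] (abse \o g) by exact: measurableT_comp.
by have -> := @ge0_integral_tshift R n i h _ mag (fun t => abse_ge0 (g t)).
Qed.

Definition supp_in (N : R) (G : E -> R) :=
  forall x, G x != 0 -> forall i, `|x 0 i| <= N.

Lemma integrable_cube_cst (N C : R) :
  mu.-integrable setT (fun t => (C * \1_(@cube R n N) t)%:E).
Proof.
have mc := @measurable_cube R n N.
apply/integrableP; split.
  by apply/measurable_EFinP; apply: measurable_funM => //; exact: measurable_indic.
rewrite (_ : (fun _ => _) = fun t => (`|C|%:E * (\1_(@cube R n N) t)%:E)%E); last first.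
  apply/funext => t; rewrite /= normrM EFinM; congr (_ * _)%E.
  by rewrite ger0_norm.
rewrite ge0_integralZl//; last by apply/measurable_EFinP; exact: measurable_indic.
rewrite integral_indic// setIT lte_mul_pinfty//.
exact: lebesgue_Rn_cube.
Qed.

Lemma supp_in_bounded (G : E -> R) N : continuous G -> supp_in N G ->
  exists2 C, 0 <= C & forall t, `|G (rot t)| <= C * \1_(@cube R n N) t.
Proof.
move=> cG sG.
have cK : compact [set v : E | forall i, v ord0 i \in `[- N, N]].
  by apply: (rV_compact (A := fun=> `[- N, N]%classic)) => _; exact: segment_compact.
have /compact_bounded[M [_ hM]] : compact (G @` [set v : E | forall i, v ord0 i \in `[- N, N]]).
  apply: continuous_compact => //.
  exact: continuous_subspaceT.
have M1 : M < `|M| + 1 by rewrite (le_lt_trans (ler_norm _))// ltrDl.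
exists (`|M| + 1) => [|t]; first by rewrite addr_ge0.
have [->|G0] := eqVneq (G (rot t)) 0; first by rewrite normr0 mulr_ge0// addr_ge0.
rewrite indicE mem_set ?mulr1; last first.
  by move=> i; have := sG _ G0 i; rewrite mxE ler_norml in_itv.
apply: (hM _ M1); exists (rot t) => //= i.
by rewrite in_itv/= -ler_norml; apply: sG.
Qed.

Lemma integrable_supp_in (G : E -> R) N : continuous G -> supp_in N G ->
  mu.-integrable setT (fun t => (G (rot t))%:E).
Proof.
move=> cG sG; have [C C0 hC] := supp_in_bounded cG sG.
apply: (le_integrable _ _ _ (integrable_cube_cst N C)) => //.
  by apply/measurable_EFinP; exact: measurable_continuous_Rn.
by move=> t _; rewrite /= lee_fin (le_trans (hC t))// ler_norm.
Qed.

Lemma continuous_translate (G : E -> R) (v : E) : continuous G ->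
  continuous (fun x : E => G (x + v)).
Proof.
move=> cG x; apply: (@continuous_comp _ _ _ (fun x : E => x + v) G); last exact: cG.
by apply: (@cvgD _ _ _ (nbhs x)); [exact: cvg_id|exact: cvg_cst].
Qed.

(** With [G i x = psi x * (d x - d (x - h e_i))], the two integrands differ by the sum over [i] of
    [G i (x + h e_i) - G i x], whose integral vanishes by translation invariance. Compact support is
    needed of [psi] only, since each [G i] inherits it. *)
Lemma discrete_integration_by_parts (psi d : E -> R) N h :
  continuous psi -> continuous d -> supp_in N psi ->
  (\int[mu]_t (\sum_i psi (rot t) *
     (2 * d (rot t) - d (rot t + h *: e i) - d (rot t - h *: e i)))%:E =
   \int[mu]_t (\sum_i (psi (rot t + h *: e i) - psi (rot t)) *
     (d (rot t + h *: e i) - d (rot t)))%:E)%E.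
Proof.
move=> cpsi cd spsi.
pose A (x : E) := \sum_i psi x * (2 * d x - d (x + h *: e i) - d (x - h *: e i)).
pose G i (x : E) := psi x * (d x - d (x - h *: e i)).
have cdN i : continuous (fun x : E => d (x - h *: e i)).
  exact: (@continuous_translate d (- (h *: e i)) cd).
have cG i : continuous (G i).
  move=> x; apply: (@continuousM _ E psi); first exact: cpsi.
  by apply: continuousB; [exact: cd|exact: cdN].
have cA : continuous A.
  move=> x; apply: (@cvg_sumr R E (nbhs x) (nbhs_filter x)) => i; apply: (@continuousM _ E psi); first exact: cpsi.
  apply: continuousB; last exact: cdN.
  apply: continuousB; last exact: continuous_translate.
  by apply: (@continuousM _ E (cst 2)); [exact: cst_continuous|exact: cd].
have sG i : supp_in N (G i).
  by move=> x Gx0; apply: spsi; apply: contraNneq Gx0; rewrite /G => ->; rewrite mul0r.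
have sA : supp_in N A.
  move=> x Ax0; apply: spsi; apply: contraNneq Ax0; rewrite /A => ->.
  by rewrite big1// => i _; rewrite mul0r.
have iA := integrable_supp_in cA sA.
have iG i := integrable_supp_in (cG i) (sG i).
pose D i (t : n.-tuple RT) : \bar R := ((G i (rot (tshift i h t)))%:E - (G i (rot t))%:E)%E.
have iD i : mu.-integrable setT (D i).
  apply: integrableB => //.
  exact: (integrable_tshift i h (iG i)).
transitivity (\int[mu]_t ((A (rot t))%:E + \sum_i D i t))%E; last first.
  apply: eq_integral => t _.
  rewrite /D; under eq_bigr do rewrite -EFinB.
  rewrite sumEFin -EFinD; congr EFin; rewrite /A -big_split/=.
  apply: eq_bigr => i _; rewrite /G row_of_tuple_tshift addrK.
  ring.
rewrite integralD//; last exact: integrable_sum.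
rewrite integral_sum// big1 ?adde0// => i _.
rewrite /D integralB//; last exact: (integrable_tshift i h (iG i)).
rewrite (integral_tshift i h (g := fun t => (G i (rot t))%:E)).
  by rewrite subee//; exact: integrable_fin_num.
by apply/measurable_EFinP; exact: measurable_continuous_Rn.
Qed.

End integration_by_parts.

(** * Weak Laplacian *)

Section limn_einf_bounds.
Context {R : realType}.
Implicit Types (u : (\bar R)^nat) (l : \bar R).

Lemma le_limn_einf u l : (\forall k \near \oo, (l <= u k)%E) -> (l <= limn_einf u)%E.
Proof.
move=> [N _ hN]; rewrite limn_einf_lim; apply: lime_ge; first exact: is_cvg_einfs.
exists N => // m Nm; apply: le_ereal_inf_tmp => _ [k /= mk <-].
by apply: hN; exact: leq_trans mk.
Qed.

Lemma limn_einf_le u l : (forall k, (u k <= l)%E) -> (limn_einf u <= l)%E.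
Proof.
move=> ul; rewrite limn_einf_lim; apply: lime_le; first exact: is_cvg_einfs.
apply: nearW => m; apply: le_trans (ul m); apply: ereal_inf_lbound.
by exists m => /=.
Qed.

Lemma limn_einf_lt u l : (limn_einf u < l)%E ->
  forall N, exists2 k, (N <= k)%N & (u k < l)%E.
Proof.
move=> ul N; apply: contrapT => h; move: ul; apply/negP; rewrite -leNgt.
apply: le_limn_einf; exists N => // k /= Nk; rewrite leNgt; apply/negP => uk.
by apply: h; exists k.
Qed.

End limn_einf_bounds.

(** * Comparison of integrals with a possibly nonmeasurable integrand *)

Section lower_integral.
Context d (T : measurableType d) (R : realType) (mu : {measure set T -> \bar R}).
Implicit Types (F G : T -> \bar R) (D : set T).
Local Open Scope ereal_scope.

(** The integral of a nonnegative function is a supremum over the simple functions below it, hence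
    monotone without any measurability. *)
Lemma ge0_le_integral_nonmeasurable F G : (forall t, 0 <= F t) ->
  (forall t, F t <= G t) -> \int[mu]_t F t <= \int[mu]_t G t.
Proof.
move=> F0 FG; rewrite !ge0_integralTE//; last by move=> t; exact: le_trans (FG t).
apply: le_ereal_sup => _ [h /= hF <-]; exists h => //= t.
exact: le_trans (FG t).
Qed.

(** The exceptional null set is absorbed by the measurable side: raising [G] to [+oo] there keeps
    its integral and makes the inequality hold everywhere. This serves the curvature integrand. *)
Lemma ae_le_integral_measurable_right D F G : (forall t, 0 <= F t) ->
  measurable_fun setT G -> (forall t, 0 <= G t) ->
  {ae mu, forall t, D t -> F t <= G t} -> \int[mu]_(t in D) F t <= \int[mu]_t G t.
Proof.
move=> F0 mG G0 [N [mN N0 FG]].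
pose G' t := if t \in N then +oo else G t.
have mG' : measurable_fun setT G'.
  apply: measurable_fun_ifT => //.
  by apply: (measurable_fun_bool true); rewrite setTI preimage_mem_true.
have -> : \int[mu]_t G t = \int[mu]_t G' t.
  apply: ae_eq_integral => //; exists N; split => // t /= /not_implyP[_ nGG'].
  by apply: contrapT => Nt; apply: nGG'; rewrite /G' memNset.
rewrite integral_mkcond; apply: ge0_le_integral_nonmeasurable => t.
  by rewrite patchE; case: ifP.
rewrite patchE /G'; case: ifPn => [/set_mem Dt|_]; last by case: ifP => _; rewrite ?leey.
case: ifPn => [_|/negP Nt]; first by rewrite leey.
by apply: contrapT => nFG; apply: Nt; apply/mem_set/FG => /= /(_ Dt).
Qed.

(** The mirror device: [G] is lowered to 0 on the null set. This serves the integrand with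
    [grad delta]. *)
Lemma ae_le_integral_measurable_left D F G : (forall t, 0 <= F t) ->
  measurable_fun setT G -> (forall t, 0 <= G t) ->
  {ae mu, forall t, G t <= (F \_ D) t} -> \int[mu]_t G t <= \int[mu]_(t in D) F t.
Proof.
move=> F0 mG G0 [N [mN N0 FG]].
pose G' t := if t \in N then 0 else G t.
have mG' : measurable_fun setT G'.
  apply: measurable_fun_ifT => //.
  by apply: (measurable_fun_bool true); rewrite setTI preimage_mem_true.
have -> : \int[mu]_t G t = \int[mu]_t G' t.
  apply: ae_eq_integral => //; exists N; split => // t /= /not_implyP[_ nGG'].
  by apply: contrapT => Nt; apply: nGG'; rewrite /G' memNset.
rewrite [leRHS]integral_mkcond; apply: ge0_le_integral_nonmeasurable => t.
  by rewrite /G'; case: ifP.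
rewrite /G'; case: ifPn => [_|/negP Nt]; first by rewrite patchE; case: ifP.
by apply: contrapT => nFG; apply: Nt; apply/mem_set/FG.
Qed.

End lower_integral.

(** * Passage to the limit in the discrete integration by parts *)

Section weak_laplacian.
Context {R : realType}.
Local Notation RT := (measurableTypeR R).
Variable n : nat.
Local Notation E := 'rV[R]_n.
Local Notation mu := (@lebesgue_Rn R n).
Local Notation rot := (@row_of_tuple R n).
Local Notation e i := (delta_mx 0 i : E).
Variables (psi d : E -> R) (N r C C' : R).
Hypotheses (cpsi : continuous psi) (cd : continuous d).
Hypotheses (spsi : supp_in N psi) (r0 : 0 < r).
Hypothesis lpsi : forall x i h, `|psi (x + h *: e i) - psi x| <= C * `|h|.
Hypothesis ld : forall x i h, `|d (x + h *: e i) - d x| <= C' * `|h|.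

(** Minus the discrete Laplacian, a sign that makes it nonnegative for concave functions. *)
Definition second_diff (g : E -> R) (h : R) (x : E) : R :=
  \sum_i (2 * g x - g (x + h *: e i) - g (x - h *: e i)) / h ^+ 2.

Definition grad_diff (g1 g2 : E -> R) (h : R) (x : E) : R :=
  \sum_i ((g1 (x + h *: e i) - g1 x) / h) * ((g2 (x + h *: e i) - g2 x) / h).

Hypothesis sd0 : forall x h, 0 < h -> h <= r -> 0 <= psi x * second_diff d h x.

Definition step (k : nat) : R := r * k.+1%:R^-1.

Lemma step_gt0 k : 0 < step k.
Proof. by rewrite mulr_gt0// invr_gt0. Qed.

Lemma step_le k : step k <= r.
Proof. by rewrite /step ler_piMr ?(ltW r0)// invf_le1 ?ler1n. Qed.

Lemma step_cvg0 : step @ \oo --> 0.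
Proof.
rewrite -(mulr0 r); apply: cvgMr.
exact: cvg_harmonic.
Qed.

(** The weight stays inside the lower limit because nonnegativity is assumed of the product only:
    [d] behaves as a concave function just where [psi] does not vanish. *)
Let Lpsi (t : n.-tuple RT) : \bar R :=
  limn_einf (fun k => (psi (rot t) * second_diff d (step k) (rot t))%:E).

Let u k (t : n.-tuple RT) : R := grad_diff psi d (step k) (rot t).

Lemma continuous_second_diff h : continuous (second_diff d h).
Proof.
move=> x; apply: (@cvg_sumr R E (nbhs x) (nbhs_filter x)) => i.
apply: (@continuousM _ E _ (cst _)); last exact: cst_continuous.
apply: continuousB.
  apply: continuousB; last exact: (@continuous_translate R n d (h *: e i) cd).
  by apply: (@continuousM _ E (cst 2)); [exact: cst_continuous|exact: cd].
exact: (@continuous_translate R n d (- (h *: e i)) cd).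
Qed.

Lemma continuous_grad_diff h : continuous (grad_diff psi d h).
Proof.
move=> x; apply: (@cvg_sumr R E (nbhs x) (nbhs_filter x)) => i.
apply: (@continuousM _ E).
  apply: (@continuousM _ E _ (cst _)); last exact: cst_continuous.
  by apply: continuousB; [exact: (@continuous_translate R n psi (h *: e i) cpsi)|exact: cpsi].
apply: (@continuousM _ E _ (cst _)); last exact: cst_continuous.
by apply: continuousB; [exact: (@continuous_translate R n d (h *: e i) cd)|exact: cd].
Qed.

Lemma integral_second_diff k :
  (\int[mu]_t (psi (rot t) * second_diff d (step k) (rot t))%:E =
   \int[mu]_t (u k t)%:E)%E.
Proof.
have h0 := step_gt0 k; set h := step k in h0 *.
have cpsi' : continuous (fun x => psi x / h ^+ 2).
  move=> x; apply: (@continuousM _ E psi (cst _)); first exact: cpsi.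
  exact: cst_continuous.
have spsi' : supp_in N (fun x => psi x / h ^+ 2).
  by move=> x; rewrite mulf_eq0 negb_or => /andP[/spsi].
have := discrete_integration_by_parts h cpsi' cd spsi'.
rewrite (_ : (fun t => _) = fun t => (psi (rot t) * second_diff d h (rot t))%:E); last first.
  apply/funext => t; congr EFin; rewrite /second_diff mulr_sumr.
  by apply: eq_bigr => i _; rewrite mulrA mulrAC.
move=> ->; apply: eq_integral => t _; congr EFin; rewrite /u /grad_diff -/h; apply: eq_bigr => i _.
by field; rewrite gt_eqF.
Qed.

(** Each of the [n] terms of the quotient is at most [C * C']. The cube is enlarged by [r] since
    [psi (x + h e_i)] with [h <= r] may be nonzero where [psi x] is 0. *)
Let dom (t : n.-tuple RT) : \bar R := ((C * C' *+ n) * \1_(@cube R n (N + r)) t)%:E.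

Lemma grad_diff_le k t : (`|(u k t)%:E| <= dom t)%E.
Proof.
have h0 := step_gt0 k; have hr := step_le k; set h := step k in h0 hr *.
rewrite /dom indicE lee_fin.
have [tN|tN] := boolP (t \in cube (N + r)).
  rewrite mulr1 (le_trans (ler_norm_sum _ _ _))// -[X in _ *+ X]card_ord -sumr_const.
  apply: ler_sum => i _; rewrite !normrM normfV (gtr0_norm h0).
  have C'0 : `|d (rot t + h *: e i) - d (rot t)| / h <= C'.
    by rewrite ler_pdivrMr// (le_trans (ld _ _ _))// gtr0_norm.
  have C0 : `|psi (rot t + h *: e i) - psi (rot t)| / h <= C.
    by rewrite ler_pdivrMr// (le_trans (lpsi _ _ _))// gtr0_norm.
  by rewrite ler_pM// divr_ge0// ltW.
rewrite mulr0 normr_le0 /u /grad_diff -/h big1// => i _.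
suff [-> ->] : psi (rot t + h *: e i) = 0 /\ psi (rot t) = 0 by rewrite subrr !mul0r.
split.
  apply/eqP; apply: contraNT tN => /spsi hN; apply/mem_set => j.
  have := hN j; rewrite !mxE in_itv/= -ler_norml => hj.
  rewrite -(addrK (h * (j == i)%:R) (tnth t j)).
  rewrite (le_trans (ler_normB _ _))// lerD//.
  by case: (j == i); rewrite ?mulr1 ?mulr0 ?normr0 ?gtr0_norm// ltW.
apply/eqP; apply: contraNT tN => /spsi hN; apply/mem_set => j.
have := hN j; rewrite !mxE in_itv/= -ler_norml => hj.
by rewrite (le_trans hj)// lerDl ltW.
Qed.

Lemma measurable_Lpsi : measurable_fun setT Lpsi.
Proof.
rewrite /Lpsi /limn_einf; apply: measurableT_comp => //.
apply: measurable_fun_limn_esup => k; apply: measurableT_comp => //.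
apply/measurable_EFinP; apply: measurable_funM; first exact: measurable_continuous_Rn.
by apply: measurable_continuous_Rn; exact: continuous_second_diff.
Qed.

Lemma measurable_u k : measurable_fun setT (EFin \o u k).
Proof.
apply/measurable_EFinP; apply: measurable_continuous_Rn.
exact: continuous_grad_diff.
Qed.

Lemma Lpsi_ge0 t : (0 <= Lpsi t)%E.
Proof.
apply: le_limn_einf; apply: nearW => k; rewrite lee_fin.
by rewrite sd0 ?step_gt0 ?step_le.
Qed.

Lemma fatou_second_diff :
  (\int[mu]_t Lpsi t <= limn_einf (fun k => \int[mu]_t (u k t)%:E))%E.
Proof.
under [in leRHS]eq_fun do rewrite -integral_second_diff.
apply: fatou => //.
- move=> k; apply/measurable_EFinP; apply: measurable_funM.
    exact: measurable_continuous_Rn.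
  by apply: measurable_continuous_Rn; exact: continuous_second_diff.
- by move=> k t _; rewrite lee_fin sd0 ?step_gt0 ?step_le.
Qed.

Lemma integrable_dom : mu.-integrable setT dom.
Proof. exact: integrable_cube_cst. Qed.

(** Fatou's lemma bounds the integral of [Lpsi] by integrals of the quotients, all at most the
    finite integral of [dom]. Everything known later about [d] at almost every point comes from this
    finiteness. *)
Lemma Lpsi_ltey : {ae mu, forall t, (Lpsi t < +oo)%E}.
Proof.
have : mu.-integrable setT Lpsi.
  apply/integrableP; split; first exact: measurable_Lpsi.
  rewrite (eq_integral Lpsi) => [|t _]; last by rewrite gee0_abs ?Lpsi_ge0.
  apply: le_lt_trans fatou_second_diff _.
  apply: (@le_lt_trans _ _ (\int[mu]_t dom t)%E).
    apply: limn_einf_le => k; apply: le_integral => //.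
    - apply: le_integrable integrable_dom => //; first exact: measurable_u.
      move=> t _; apply: le_trans (grad_diff_le k t) _; exact: lee_abs.
    - exact: integrable_dom.
    - by move=> t _; apply: le_trans (grad_diff_le k t); exact: lee_abs.
  have /integrableP[_] := integrable_dom; apply: le_lt_trans.
  apply: (le_trans (lee_abs _)); apply: le_abse_integral => //.
  by have /integrableP[] := integrable_dom.
move=> /(integrable_ae measurableT); apply: filterS => t /(_ I).
by rewrite ge0_fin_numE ?Lpsi_ge0.
Qed.

(** [Lam] need not be measurable, so the upper limit [Lm] of the quotients, measurable and almost
    everywhere equal to [Lam], stands for it under the integral. Dominated convergence identifies
    the right-hand side of Fatou's lemma with the integral of [Lm]. *)
Lemma weak_laplacian_le (Lam : E -> R) :
  {ae mu, forall t, grad_diff psi d (step k) (rot t) @[k --> \oo] --> Lam (rot t)} ->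
  exists Lm : n.-tuple RT -> \bar R,
   [/\ mu.-integrable setT Lm, {ae mu, forall t, Lm t = (Lam (rot t))%:E} &
   (\int[mu]_t Lpsi t <= \int[mu]_t Lm t)%E].
Proof.
move=> hLam.
pose Lm t := limn_esup (fun k => (u k t)%:E).
have cvL : {ae mu, forall t, (u k t)%:E @[k --> \oo] --> (Lam (rot t))%:E}.
  by apply: filterS hLam => t ht; apply: cvg_EFin => //; exact: nearW.
have aeL : {ae mu, forall t, Lm t = (Lam (rot t))%:E}.
  by apply: filterS cvL => t /cvg_limn_einf_sup[_].
have mLm : measurable_fun setT Lm.
  by apply: measurable_fun_limn_esup => k; exact: measurable_u.
have [iLm _ cv] := @dominated_convergence _ _ _ mu setT measurableT
  (fun k t => (u k t)%:E) Lm dom measurable_u mLm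
  (filterS2 _ (fun t (h1 : Lm t = _) (h2 : _ --> _) _ => (eq_ind_r (fun z => _ @ \oo --> z) h2 h1)) aeL cvL)
  integrable_dom (aeW _ (fun t k _ => grad_diff_le k t)).
exists Lm; split => //.
apply: le_trans fatou_second_diff _.
by have [-> _] := cvg_limn_einf_sup cv.
Qed.

End weak_laplacian.

(** * Euclidean norm and distance to the complement *)

Section euclidean_norm.
Context {R : realType} {n : nat}.
Local Notation E := 'rV[R]_n.
Implicit Types (x y z u v w : E) (a t : R).

Lemma dotpC x y : dotp x y = dotp y x.
Proof. by apply: eq_bigr => i _; rewrite mulrC. Qed.

Lemma dotpDl x y z : dotp (x + y) z = dotp x z + dotp y z.
Proof. by rewrite /dotp -big_split; apply: eq_bigr => i _; rewrite mxE mulrDl. Qed.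

Lemma dotpZl a x y : dotp (a *: x) y = a * dotp x y.
Proof. by rewrite /dotp mulr_sumr; apply: eq_bigr => i _; rewrite mxE mulrA. Qed.

Lemma dotpNl x y : dotp (- x) y = - dotp x y.
Proof. by rewrite -scaleN1r dotpZl mulN1r. Qed.

Lemma dotpBl x y z : dotp (x - y) z = dotp x z - dotp y z.
Proof. by rewrite dotpDl dotpNl. Qed.

Lemma dotpDr x y z : dotp z (x + y) = dotp z x + dotp z y.
Proof. by rewrite dotpC dotpDl !(dotpC z). Qed.

Lemma dotpZr a x y : dotp x (a *: y) = a * dotp x y.
Proof. by rewrite dotpC dotpZl dotpC. Qed.

Lemma dotpNr x y : dotp x (- y) = - dotp x y.
Proof. by rewrite dotpC dotpNl dotpC. Qed.

Lemma dotpBr x y z : dotp z (x - y) = dotp z x - dotp z y.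
Proof. by rewrite dotpDr dotpNr. Qed.

Lemma dotp0l x : dotp 0 x = 0.
Proof. by rewrite -(scale0r 0) dotpZl mul0r. Qed.

Lemma dotp0r x : dotp x 0 = 0.
Proof. by rewrite dotpC dotp0l. Qed.

Lemma dotp_suml I (r : seq I) (P : pred I) (F : I -> E) y :
  dotp (\sum_(i <- r | P i) F i) y = \sum_(i <- r | P i) dotp (F i) y.
Proof.
apply: (big_ind2 (fun x s => dotp x y = s)) => //; first exact: dotp0l.
by move=> x1 s1 x2 s2 <- <-; rewrite dotpDl.
Qed.

Lemma dotp_sumr I (r : seq I) (P : pred I) (F : I -> E) y :
  dotp y (\sum_(i <- r | P i) F i) = \sum_(i <- r | P i) dotp y (F i).
Proof. by rewrite dotpC dotp_suml; apply: eq_bigr => i _; rewrite dotpC. Qed.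

Lemma dotp_delta x i : dotp x (delta_mx 0 i) = x 0 i.
Proof.
rewrite /dotp (bigD1 i)//= !mxE !eqxx mulr1 big1 ?addr0// => j /negbTE ji.
by rewrite mxE ji mulr0.
Qed.

Lemma dotp_ge0 x : 0 <= dotp x x.
Proof. by apply: sumr_ge0 => i _; rewrite -expr2 sqr_ge0. Qed.

Lemma dotp_eq0 x : dotp x x = 0 -> x = 0.
Proof.
move=> /eqP; rewrite psumr_eq0 => [|i _]; last by rewrite -expr2 sqr_ge0.
move=> /allP h; apply/rowP => i; rewrite mxE; apply/eqP.
by have := h i (mem_index_enum i); rewrite mulf_eq0 orbb.
Qed.

Lemma enorm_ge0 x : 0 <= enorm x. Proof. exact: sqrtr_ge0. Qed.

Lemma enorm_sqr x : enorm x ^+ 2 = dotp x x.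
Proof. by rewrite sqr_sqrtr// dotp_ge0. Qed.

Lemma enormZ a x : enorm (a *: x) = `|a| * enorm x.
Proof. by rewrite /enorm dotpZl dotpZr mulrA -expr2 sqrtrM ?sqr_ge0// sqrtr_sqr. Qed.

Lemma enormN x : enorm (- x) = enorm x.
Proof. by rewrite -scaleN1r enormZ normrN1 mul1r. Qed.

Lemma enormB x y : enorm (x - y) = enorm (y - x).
Proof. by rewrite -enormN opprB. Qed.

Lemma enorm0 : enorm (0 : E) = 0.
Proof. by rewrite /enorm dotp0l sqrtr0. Qed.

Lemma enorm_eq0 x : enorm x = 0 -> x = 0.
Proof. by move=> x0; apply: dotp_eq0; rewrite -enorm_sqr x0 expr0n. Qed.

(** Cauchy-Schwarz, by expanding the square of [enorm y *: x - enorm x *: y]. *)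
Lemma dotp_le x y : dotp x y <= enorm x * enorm y.
Proof.
have [/enorm_eq0 ->|x0] := eqVneq (enorm x) 0; first by rewrite dotp0l enorm0 mul0r.
have [/enorm_eq0 ->|y0] := eqVneq (enorm y) 0; first by rewrite dotp0r enorm0 mulr0.
have xp : 0 < enorm x by rewrite lt_neqAle eq_sym x0 enorm_ge0.
have yp : 0 < enorm y by rewrite lt_neqAle eq_sym y0 enorm_ge0.
have := dotp_ge0 (enorm y *: x - enorm x *: y).
rewrite !(dotpBl, dotpBr, dotpZl, dotpZr) -!enorm_sqr (dotpC y x) => h.
rewrite -subr_ge0 -(pmulr_rge0 _ (mulr_gt0 xp yp)); nra.
Qed.

Lemma ler_enormD x y : enorm (x + y) <= enorm x + enorm y.
Proof.
rewrite -(@ler_pXn2r _ 2)// ?nnegrE ?addr_ge0 ?enorm_ge0//.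
rewrite enorm_sqr dotpDl !dotpDr (dotpC y x) sqrrD -!enorm_sqr.
have := dotp_le x y; lra.
Qed.

Lemma ler_enormB_dist x y z : enorm (x - z) <= enorm (x - y) + enorm (y - z).
Proof. by rewrite -[x - z](subrKA y) ler_enormD. Qed.

Lemma enorm_delta i : enorm (delta_mx 0 i : E) = 1.
Proof. by rewrite /enorm dotp_delta mxE !eqxx sqrtr1. Qed.

Lemma coord_le_enorm x i : `|x 0 i| <= enorm x.
Proof.
rewrite -sqrtr_sqr ler_wsqrtr// /dotp (bigD1 i)//= -expr2 lerDl.
by apply: sumr_ge0 => j _; rewrite -expr2 sqr_ge0.
Qed.

Lemma enorm_le_norm x : enorm x <= n%:R * `|x|.
Proof.
have xi i : `|x 0 i| <= `|x|.
  rewrite [leRHS]/Num.norm/= mx_normrE.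
  by apply/bigmax_geP; right; exists (0, i).
have {1}-> : x = \sum_i x 0 i *: delta_mx 0 i.
  by rewrite {1}(row_sum_delta x).
apply: (@le_trans _ _ (\sum_(i < n) `|x 0 i|)).
  apply: (big_ind2 (fun y s => enorm y <= s)) => [|y1 s1 y2 s2 h1 h2|i _].
  - by rewrite enorm0.
  - by rewrite (le_trans (ler_enormD _ _))// lerD.
  - by rewrite enormZ enorm_delta mulr1.
by rewrite (le_trans (ler_sum _ (fun i _ => xi i)))// sumr_const card_ord mulr_natl.
Qed.

Lemma norm_le_enorm x : `|x| <= enorm x.
Proof.
rewrite [leLHS]/Num.norm/= mx_normrE; apply: bigmax_le; first exact: enorm_ge0.
by move=> [i j] _ /=; rewrite (ord1 i) coord_le_enorm.
Qed.

Lemma nbhs_enorm_ball x r : 0 < r -> nbhs x [set y | enorm (y - x) < r].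
Proof.
(* The Euclidean norm is at most [n] times the sup norm; the [+ 1] avoids a zero denominator in
   dimension 0. *)
move=> r0; apply/nbhs_ballP; exists (r / (n%:R + 1)) => /=.
  by rewrite divr_gt0// ltr_wpDl.
move=> y; rewrite -ball_normE /= => xy.
have n0 : 0 <= n%:R :> R by [].
rewrite (le_lt_trans (enorm_le_norm _))// distrC.
rewrite ltr_pdivlMr ?ltr_wpDl// in xy.
rewrite (le_lt_trans _ xy)// mulrC ler_wpM2l//; lra.
Qed.

Lemma nbhs_enormP x (A : set E) :
  nbhs x A -> exists2 r, 0 < r & forall y, enorm (y - x) < r -> A y.
Proof.
move=> /nbhs_ballP[r /= r0 rA]; exists r => // y yx; apply: rA.
by rewrite -ball_normE /= distrC (le_lt_trans (norm_le_enorm _)).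
Qed.

Lemma enorm_lipschitz_continuous (g : E -> R) (C : R) :
  (forall x y, `|g x - g y| <= C * enorm (x - y)) -> continuous g.
Proof.
move=> hg x; apply/(@cvgrPdist_lt _ _ _ _ (nbhs_filter x)) => eps eps0.
have C1 : 0 < `|C| + 1 by rewrite ltr_wpDl.
apply: (@filterS _ _ (nbhs_filter x) _ _ _ (nbhs_enorm_ball x (divr_gt0 eps0 C1))) => y /=.
rewrite ltr_pdivlMr// => yx; rewrite (le_lt_trans (hg _ _))// enormB.
rewrite (le_lt_trans _ yx)// mulrC ler_wpM2l ?enorm_ge0//.
by rewrite (le_trans (ler_norm _))// lerDl.
Qed.

Lemma continuous_enorm : continuous (@enorm R n).
Proof.
apply: (enorm_lipschitz_continuous (C := 1)) => x y; rewrite mul1r ler_distlC.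
have := ler_enormD (x - y) y; have := ler_enormD (y - x) x.
by rewrite !subrK (enormB y x) => h1 h2; apply/andP; split; lra.
Qed.

End euclidean_norm.

Section distance.
Context {R : realType} {n : nat}.
Local Notation E := 'rV[R]_n.
Variable Omega : set E.
Hypotheses (oO : open Omega) (cO : convex_set Omega) (C0 : ~` Omega !=set0).
Implicit Types x y z : E.
Local Notation d := (delta Omega).

Let dset x := [set enorm (x - y) | y in ~` Omega].

Let has_inf_dset x : has_inf (dset x).
Proof.
have [y Oy] := C0; split; first by exists (enorm (x - y)), y.
by exists 0 => _ [z _ <-]; exact: enorm_ge0.
Qed.

Lemma delta_le x y : ~ Omega y -> d x <= enorm (x - y).
Proof. by move=> Oy; apply: ge_inf; [have [] := has_inf_dset x|exists y]. Qed.

Lemma delta_ge x r : (forall y, ~ Omega y -> r <= enorm (x - y)) -> r <= d x.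
Proof.
move=> h; apply: lb_le_inf; first by have [] := has_inf_dset x.
by move=> _ [y Oy <-]; apply: h.
Qed.

Lemma delta_ge0 x : 0 <= d x.
Proof. by apply: delta_ge => y _; exact: enorm_ge0. Qed.

Lemma delta_lipschitz x y : `|d x - d y| <= enorm (x - y).
Proof.
have h u v : d u <= d v + enorm (u - v).
  rewrite -lerBlDr; apply: delta_ge => w Ow; rewrite lerBlDr addrC.
  exact: le_trans (delta_le u Ow) (ler_enormB_dist _ _ _).
by rewrite ler_distlC; have := h x y; have := h y x; rewrite (enormB y x) => *; apply/andP; split; lra.
Qed.

Lemma continuous_delta : continuous d.
Proof.
by apply: (enorm_lipschitz_continuous (C := 1)) => x y; rewrite mul1r delta_lipschitz.
Qed.

Lemma delta_ball x y : enorm (x - y) < d x -> Omega y.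
Proof. by move=> xy; apply: contrapT => /(delta_le x); rewrite leNgt xy. Qed.

Lemma delta_gt0 x : Omega x -> 0 < d x.
Proof.
move=> Ox; have [r r0 hr] := nbhs_enormP (open_nbhs_nbhs (conj oO Ox)).
apply: (lt_le_trans r0); apply: delta_ge => y Oy; rewrite leNgt; apply/negP.
by rewrite enormB => /hr.
Qed.

Lemma bdry_notin y : bdry Omega y -> ~ Omega y.
Proof. by move=> [_]; move/interior_id: oO => ->. Qed.

Lemma convex_comb t x y : 0 <= t -> t <= 1 -> Omega x -> Omega y ->
  Omega (t *: x + (1 - t) *: y).
Proof.
move=> t0 t1 Ox Oy.
by have := @cO x y (Itv01 t0 t1) (mem_set Ox) (mem_set Oy); rewrite inE.
Qed.

(** The distance to [x] is minimised over a compact part of the complement. The minimiser is a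
    boundary point because points of the segment towards [x] lie in the inscribed ball, arbitrarily
    close to it. *)
Lemma near_point_exists x : Omega x -> exists y, near_points Omega x y.
Proof.
move=> Ox; have d0 := delta_gt0 Ox.
pose K := ~` Omega `&` [set y | enorm (y - x) <= d x + 1].
have cf : continuous (fun y => enorm (y - x)).
  exact: (@continuous_translate R n _ (- x) continuous_enorm).
have clK : closed K.
  apply: closedI; first exact: open_closedC.
  by apply: (@closed_comp _ _ (fun y => enorm (y - x)) [set r | r <= d x + 1]).
have bK : bounded_set K.
  exists (enorm x + d x + 1); split; first exact: num_real.
  move=> M hM y [_ /= yx]; rewrite (le_trans (norm_le_enorm _))//.
  have := ler_enormD (y - x) x; rewrite subrK; lra.
have K0 : K !=set0.
  have [_ [y Oy <-] yd] : exists2 r, dset x r & r < inf (dset x) + 1.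
    by apply: inf_adherent.
  by exists y; split => //=; rewrite enormB ltW.
have [y /set_mem[Oy _] hy] := EVT_min_rV K0 (bounded_closed_compact bK clK)
  (continuous_subspaceT cf).
have yd : enorm (y - x) = d x.
  apply/eqP; rewrite eq_le [X in _ && X](_ : _ = true); last first.
    by rewrite enormB delta_le.
  rewrite andbT; apply: delta_ge => z Oz; rewrite (enormB x z).
  have [zx|zx] := leP (enorm (z - x)) (d x + 1).
    by apply: hy; apply/mem_set; split.
  have [w [Ow wx]] := K0.
  apply: ltW; apply: le_lt_trans zx.
  by apply: (le_trans (hy w _)) => //; apply/mem_set; split.
exists y; split => //; split; last by move=> /interior_subset.
move=> B /nbhs_enormP[r r0 hr].
(* The bound [1/2] keeps the point at distance [(1 - s) * d x < d x] from [x]; the other bound keeps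
   it in the given neighbourhood of [y]. *)
pose s := Num.min (1/2) (r / (2 * d x)).
have s0 : 0 < s by rewrite lt_min !divr_gt0// mulr_gt0.
have s1 : s <= 1/2 by rewrite /s ge_min lexx.
have sr : s * d x < r.
  rewrite (@le_lt_trans _ _ (r / 2))//; last by lra.
  rewrite (@le_trans _ _ (r / (2 * d x) * d x))//.
    by apply: ler_wpM2r; rewrite ?(ltW d0)// /s ge_min lexx orbT.
  by rewrite le_eqVlt; apply/orP; left; apply/eqP; field; rewrite gt_eqF.
exists (y + s *: (x - y)); split.
  apply: (@delta_ball x).
  rewrite (_ : x - _ = (1 - s) *: (x - y)); last first.
    by rewrite scalerBl scale1r opprD addrA.
  rewrite enormZ enormB yd ger0_norm; last by lra.
  nra.
by apply: hr; rewrite addrAC subrr add0r enormZ enormB yd gtr0_norm.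
Qed.

(** A point outside [Omega] too close to [m] has the form [m + s u] with [|u| < 1]. It is then the
    same convex combination of [x + d x u] and [y + d y u], which lie in the inscribed balls, and
    convexity puts it in [Omega]. *)
Lemma delta_concave t x y : 0 <= t -> t <= 1 -> Omega x -> Omega y ->
  t * d x + (1 - t) * d y <= d (t *: x + (1 - t) *: y).
Proof.
move=> t0 t1 Ox Oy; apply: delta_ge => z Oz; rewrite leNgt; apply/negP => zs.
apply: Oz.
have dx := delta_gt0 Ox; have dy := delta_gt0 Oy.
set m := t *: x + (1 - t) *: y in zs *; set s := t * d x + (1 - t) * d y in zs.
have s0 : 0 < s by apply: le_lt_trans zs; exact: enorm_ge0.
have [u [u1 ->]] : exists u, enorm u < 1 /\ z = m + s *: u.
  exists (s^-1 *: (z - m)); split; last by rewrite scalerA divff ?gt_eqF// scale1r subrKC.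
  by rewrite enormZ gtr0_norm ?invr_gt0// mulrC ltr_pdivrMr// mul1r enormB.
have -> : m + s *: u = t *: (x + d x *: u) + (1 - t) *: (y + d y *: u).
  by rewrite !scalerDr !scalerA addrACA -scalerDl.
apply: convex_comb => //; [apply: (@delta_ball x)|apply: (@delta_ball y)].
  by rewrite opprD addNKr enormN enormZ gtr0_norm// gtr_pMr.
by rewrite opprD addNKr enormN enormZ gtr0_norm// gtr_pMr.
Qed.

End distance.

(** * Calculus *)

Section one_variable.
Context {R : realType}.

Lemma is_derive1P (W : normedModType R) (g : R -> W) (t : R) (dg : W) :
  is_derive (t : R^o) 1 g dg <->
  h^-1 *: (g (t + h) - g t) @[h --> 0^'] --> dg.
Proof.
have -> : (fun h => h^-1 *: (g (t + h) - g t)) =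
          (fun h : R => h^-1 *: ((g \o shift t) (h *: 1) - g t)).
  apply/funext => h /=; congr (_ *: (g _ - _)).
  by rewrite addrC; congr (_ + _); exact/esym/mulr1.
split=> [[dg1 <-]//|cg].
by split; [apply/cvg_ex; exists dg|exact/cvg_lim].
Qed.

Lemma mean_value (g g1 : R -> R) (s : R) :
  (forall t : R, `|t| <= `|s| -> is_derive t 1 g (g1 t)) ->
  exists2 xi, `|xi| <= `|s| & g s - g 0 = g1 xi * s.
Proof.
move=> dg.
have cg a b : `|a| <= `|s| -> `|b| <= `|s| -> {within `[a, b], continuous g}.
  rewrite !ler_norml => /andP[ha _] /andP[_ hb].
  apply: derivable_within_continuous => t; rewrite in_itv/= => /andP[ta tb].
  have [] // : is_derive t 1 g (g1 t).
  by apply: dg; rewrite ler_norml; apply/andP; split; lra.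
have n0 : `|0 : R| <= `|s| by rewrite normr0.
have [s0|s0|<-] := ltgtP 0 s; last first.
- by exists 0; rewrite ?subrr ?mulr0.
- have [x /itvP x0|xi /itvP xi0 e] := @MVT _ g g1 s 0 s0 _ (cg _ _ (lexx _) n0).
    by apply: dg; rewrite !ler0_norm ?lerN2 ?x0// ltW.
  exists xi; first by rewrite !ler0_norm ?lerN2 ?xi0// ltW.
  by rewrite -opprB e sub0r mulrN opprK.
- have [x /itvP x0|xi /itvP xi0 e] := @MVT _ g g1 0 s s0 _ (cg _ _ n0 (lexx _)).
    by apply: dg; rewrite !ger0_norm ?x0// ltW.
  exists xi; first by rewrite !ger0_norm ?xi0// ltW.
  by rewrite e subr0.
Qed.

(** Since [g1] is differentiable only at 0, the mean value theorem is applied once, to the remainder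
    [k], whose derivative [k1] is [o(s)]. *)
Lemma peano_taylor2 (g g1 : R -> R) (b : R) :
  (\forall t \near (0 : R), is_derive (t : R) 1 g (g1 t)) -> is_derive (0 : R) 1 g1 b ->
  (g t - g 0 - t * g1 0) / t ^+ 2 @[t --> 0^'] --> b / 2.
Proof.
move=> [r /= r0 dg] /is_derive1P dg1.
apply/cvgrPdist_le => eps eps0.
have /cvgrPdist_le/(_ _ eps0)[r' /= r'0 hr'] := dg1.
exists (Num.min r r') => /=; first by rewrite lt_min r0 r'0.
move=> t /=; rewrite sub0r normrN lt_min => /andP[tr tr'] t0.
pose k s := g s - s * g1 0 - b / 2 * s ^+ 2.
pose k1 s := g1 s - g1 0 - b * s.
have [s st|xi xit e] := @mean_value k k1 t.
  have ds : is_derive s 1 g (g1 s).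
    by apply: dg => /=; rewrite sub0r normrN (le_lt_trans st).
  rewrite /k; apply: is_derive_eq.
  have sE (u v : R^o) : u *: v = u * v by [].
  by rewrite /k1 !sE; field.
have -> : (g t - g 0 - t * g1 0) / t ^+ 2 = b / 2 + k1 xi * t / t ^+ 2.
  by rewrite -e /k; field.
rewrite opprD addNKr normrN normf_div normrM normrX.
have tp : 0 < `|t| by rewrite normr_gt0.
rewrite expr2 invfM mulrA mulfK ?gt_eqF// ler_pdivrMr//.
apply: (@le_trans _ _ (eps * `|xi|)); last by rewrite ler_pM2l.
have [->|xi0] := eqVneq xi 0; first by rewrite /k1 subrr mulr0 subrr normr0 mulr0.
have := hr' xi; rewrite /= sub0r normrN => /(_ (le_lt_trans xit tr') xi0).
rewrite add0r distrC (_ : _ - b = k1 xi / xi); last first.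
  by rewrite /k1 /GRing.scale/=; field.
by rewrite normf_div ler_pdivrMr// normr_gt0.
Qed.

Lemma is_derive_min (g : R -> R) (b : R) :
  is_derive (0 : R) 1 g b -> (\forall t \near (0 : R), g 0 <= g t) -> b = 0.
Proof.
move=> /is_derive1P/cvgrPdist_lt dg [r /= r0 hr]; apply: contrapT => /eqP b0.
have b0' : 0 < `|b| by rewrite normr_gt0.
have [r' /= r'0 hr'] := dg _ b0'.
pose m := Num.min r r' / 2.
have m0 : 0 < m by rewrite divr_gt0// lt_min r0 r'0.
have mr : m < Num.min r r' by move: m0; rewrite /m; lra.
move: mr; rewrite lt_min => /andP[mr mr'].
have hp := hr' m; have hn := hr' (- m).
rewrite /= !sub0r !normrN (gtr0_norm m0) oppr_eq0 gt_eqF// in hp hn.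
have {hp} := hp mr' isT; have {hn} := hn mr' isT.
have g1 := hr m; have g2 := hr (- m); rewrite /= !sub0r !normrN (gtr0_norm m0) in g1 g2.
rewrite !add0r invrN scaleNr.
have p1 : 0 <= m^-1 *: (g m - g 0) by rewrite mulr_ge0 ?invr_ge0 ?(ltW m0)// subr_ge0 g1.
have p2 : 0 <= m^-1 *: (g (- m) - g 0) by rewrite mulr_ge0 ?invr_ge0 ?(ltW m0)// subr_ge0 g2.
have [bp|bn|b00] := ltgtP 0 b; last by rewrite -b00 eqxx in b0.
- by rewrite (gtr0_norm bp) opprK !ltr_norml => h1 h2; lra.
- by rewrite (ltr0_norm bn) opprK !ltr_norml => h1 h2; lra.
Qed.

End one_variable.

Section continuous_partials.
Context {R : realType} (k : nat).
Local Notation E := 'rV[R]_k.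
Local Notation e i := (delta_mx 0 i : E).
Variables (V : set E) (F : E -> R) (G : 'I_k -> E -> R).
Hypothesis oV : open V.
Hypothesis dF : forall x i, V x -> derivable F x (e i).
Hypothesis FG : forall x i, V x -> 'D_(e i) F x = G i x.
Hypothesis cG : forall x i, V x -> {for x, continuous (G i)}.

Lemma is_derive_coord_line x i s : V (x + s *: e i) ->
  is_derive s 1 (fun t : R => F (x + t *: e i)) (G i (x + s *: e i)).
Proof.
move=> Vx; apply/is_derive1P; rewrite -FG//.
have := @dF _ i Vx; rewrite /derivable => /cvg_ex[l hl].
rewrite /derive (cvg_lim _ hl)//; apply: cvg_trans hl.
apply: near_eq_cvg; apply: nearW => h /=.
by rewrite (addrC s) scalerDl addrCA addrA.
Qed.

(** The displacement is made one coordinate at a time, with the mean value theorem on each leg.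
    Every intermediate point has coordinates bounded by those of [v], so it stays in the sup-norm
    ball where the partial derivatives vary by at most [eps]. *)
Lemma C1_first_order q : V q -> forall eps, 0 < eps -> exists2 rho, 0 < rho &
  forall v, `|v| < rho ->
    `|F (q + v) - F q - \sum_i v 0 i * G i q| <= eps * \sum_i `|v 0 i|.
Proof.
move=> Vq eps eps0.
have [rho rho0 hrho] : exists2 rho, 0 < rho & forall x, `|x - q| < rho ->
    V x /\ forall i, `|G i q - G i x| <= eps.
  have : nbhs q (V `&` [set x | forall i, `|G i q - G i x| <= eps]).
    apply: filterI; first exact: (open_nbhs_nbhs (conj oV Vq)).
    apply: (@filter_forall _ _ _ _ (nbhs_filter q)) => i.
    by have /(@cvgrPdist_le _ _ _ _ (nbhs_filter q)) := @cG _ i Vq; apply.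
  move=> /nbhs_ballP[rho /= rho0 h]; exists rho => // x xq.
  by have [|Vx hx] := h x; [rewrite -ball_normE /= distrC|split].
exists rho => // v vrho.
pose w (s : seq 'I_k) : E := \sum_(i <- s) v 0 i *: e i.
have wE s j : uniq s -> w s 0 j = if j \in s then v 0 j else 0.
  move=> us; rewrite /w summxE; case: ifPn => js.
    rewrite (bigD1_seq j)//= !mxE !eqxx mulr1 big1 ?addr0// => i /negbTE ij.
    by rewrite !mxE eq_sym ij mulr0.
  rewrite big1_seq// => i /andP[_ iS]; rewrite !mxE (_ : (j == i) = false) ?mulr0//.
  by apply: contraNF js => /eqP ->.
have wn s (t : R) i : uniq (i :: s) -> `|t| <= `|v 0 i| -> `|w s + t *: e i| < rho.
  move=> /= /andP[iNs us] tv; apply: le_lt_trans vrho.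
  rewrite [leLHS]/Num.norm/= mx_normrE; apply: bigmax_le => // -[i' j] _ /=.
  rewrite (ord1 i') !mxE wE// eqxx/=.
  apply: (@le_trans _ _ `|v 0 j|); last first.
    rewrite [leRHS]/Num.norm/= mx_normrE; apply/bigmax_geP; right; by exists (0, j).
  have [->|ji] := eqVneq j i; first by rewrite (negbTE iNs) add0r mulr1.
  by rewrite mulr0 addr0; case: ifP => _; rewrite ?normr0.
have main s : uniq s ->
    `|F (q + w s) - F q - \sum_(i <- s) v 0 i * G i q| <= eps * \sum_(i <- s) `|v 0 i|.
  elim: s => [_|i s IH us].
    by rewrite /w !big_nil addr0 subrr subrr normr0 mulr0.
  have us' : uniq s by move: us => /= /andP[].
  have [t tv|xi xiv exi] := @mean_value R (fun t => F (q + w s + t *: e i))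
      (fun t => G i (q + w s + t *: e i)) (v 0 i).
    apply: is_derive_coord_line; apply: (hrho _ _).1.
    by rewrite -(addrA q) (addrC q) addrK; exact: wn.
  have -> : q + w (i :: s) = q + w s + v 0 i *: e i.
    by rewrite /w big_cons -addrA [X in q + X]addrC.
  rewrite scale0r addr0 in exi.
  rewrite !big_cons mulrDr.
  have -> : F (q + w s + v 0 i *: e i) - F q - (v 0 i * G i q + \sum_(j <- s) v 0 j * G j q)
    = (G i (q + w s + xi *: e i) - G i q) * v 0 i +
      (F (q + w s) - F q - \sum_(j <- s) v 0 j * G j q).
    rewrite mulrBl -exi; ring.
  rewrite (le_trans (ler_normD _ _))// lerD ?IH// normrM ler_wpM2r// distrC.
  apply: (hrho _ _).2.
  by rewrite -(addrA q) (addrC q) addrK; exact: wn.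
have := main (index_enum 'I_k) (index_enum_uniq _).
by rewrite /w -row_sum_delta.
Qed.

Lemma C1_is_derive_line q r (t : R) : V (q + t *: r) ->
  is_derive t 1 (fun t : R => F (q + t *: r)) (\sum_i r 0 i * G i (q + t *: r)).
Proof.
move=> Vq; set x := q + t *: r in Vq *.
apply/is_derive1P/cvgrPdist_le => eps eps0.
pose M := \sum_i `|r 0 i|.
have M0 : 0 <= M by apply: sumr_ge0.
have [|rho rho0 hrho] := C1_first_order Vq (eps := eps / (M + 1)).
  by rewrite divr_gt0// ltr_wpDl.
exists (rho / (`|r| + 1)) => /=; first by rewrite divr_gt0// ltr_wpDl.
move=> h /=; rewrite sub0r normrN ltr_pdivlMr ?ltr_wpDl// => hr h0.
have hp : 0 < `|h| by rewrite normr_gt0.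
have := hrho (h *: r); rewrite normrZ => /(_ _).
have hr' : `|h| * `|r| < rho by rewrite (le_lt_trans _ hr)// ler_wpM2l// lerDl.
move=> /(_ hr'){hr'}.
rewrite (_ : \sum_i (h *: r) 0 i * _ = h * \sum_i r 0 i * G i x); last first.
  by rewrite mulr_sumr; apply: eq_bigr => i _; rewrite mxE mulrA.
rewrite (_ : \sum_i `|(h *: r) 0 i| = `|h| * M); last first.
  by rewrite mulr_sumr; apply: eq_bigr => i _; rewrite mxE normrM.
have -> : q + (t + h) *: r = x + h *: r by rewrite scalerDl addrA.
move=> hF; rewrite distrC -(ler_pM2l hp) -normrM /GRing.scale/= mulrBr mulVKf//.
apply: (le_trans hF); rewrite mulrCA; apply: ler_wpM2l; first exact: ltW.
by rewrite mulrAC ler_pdivrMr ?ltr_wpDl// ler_pM2l// lerDl.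
Qed.

End continuous_partials.

(** * Charts of the boundary *)

Section boundary_curves.
Context {R : realType}.

Lemma C2_is_derive_line k (V : set 'rV[R]_k) (phi : 'rV[R]_k -> R) (q r : 'rV[R]_k) :
  open V -> Ck 2 V phi -> V q ->
  let G1 (t : R) := \sum_i r 0 i * partial i phi (q + t *: r) in
  (\forall t \near (0 : R), is_derive (t : R) 1 (fun t : R => phi (q + t *: r)) (G1 t)) /\
  is_derive (0 : R) 1 G1 (\sum_i r 0 i * \sum_j r 0 j * partial j (partial i phi) q).
Proof.
move=> oV [_ C2] Vq G1; split.
  have nV : \forall t \near (0 : R), V (q + t *: r).
    have ct : (q + t *: r) @[t --> (0 : R)] --> q.
      rewrite -[X in _ --> X](addr0 q) -[X in _ --> q + X](scale0r r).
      by apply: cvgD; [exact: cvg_cst|apply: cvgZr_tmp; exact: cvg_id].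
    by apply: ct; exact: (open_nbhs_nbhs (conj oV Vq)).
  apply: filterS nV => t Vt.
  apply: (@C1_is_derive_line R k V phi (fun i => partial i phi)) => //.
  - by move=> x i Vx; apply: (C2 i).1.
  - by move=> x i Vx; apply: (C2 i).2.1.
rewrite (_ : G1 = \sum_(i < k) (r 0 i *: (fun t : R => partial i phi (q + t *: r)))); last first.
  by apply/funext => t; rewrite fct_sumE.
apply: is_derive_sum => i; apply: is_deriveZ.
have {2}-> : q = q + 0 *: r by rewrite scale0r addr0.
apply: (@C1_is_derive_line R k V (partial i phi) (fun j => partial j (partial i phi))) => //.
- by move=> x j Vx; apply: ((C2 i).2.2 j).1.
- by move=> x j Vx; apply: ((C2 i).2.2 j).2.1.
- by rewrite scale0r addr0.
Qed.

(* The boundary curves through [y], one for each direction [z]: the graph is entered along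
   the fixed axis [Ev], and the second derivative of [G] is the quadratic form of [M]. *)
Lemma boundary_chart n (Omega : set 'rV[R]_n) y :
  Ck_boundary 2 Omega -> bdry Omega y ->
  exists (Ev : 'rV[R]_n) (M : 'M[R]_n), forall z, exists G G1 : R -> R,
    [/\ G 0 = 0, \forall t \near (0 : R), bdry Omega (y + t *: z + G t *: Ev),
        \forall t \near (0 : R), is_derive (t : R) 1 G (G1 t) &
        is_derive (0 : R) 1 G1 (dotp (z *m M) z)].
Proof.
move=> C2 by_; have [Q [i0 [U [V [phi [[QQ _ [oU Uy] oV C2phi] chart]]]]]] := C2 y by_.
have QQ' : Q^T *m Q = 1%:M by apply: mulmx1C.
pose P := col' i0 Q; pose q0 := y *m P.
have col'E (z : 'rV[R]_n) : col' i0 (z *m Q) = z *m P.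
  by apply/rowP => j; rewrite !mxE; apply: eq_bigr => l _; rewrite !mxE.
have [Vq0 /iffLR/(_ by_) yphi] := chart y Uy; rewrite col'E in Vq0 yphi.
pose H := \matrix_(i, j) partial j (partial i phi) q0.
exists (delta_mx 0 i0 *m Q^T), (P *m H *m P^T) => z.
pose r := z *m P.
have [dG dG1] := C2_is_derive_line r oV C2phi Vq0.
pose c := (z *m Q) 0 i0.
(* In rotated coordinates [t z] moves the graph variable by [t r] and the height by [c t]; [G] is
   the missing height. *)
pose G (t : R) := phi (q0 + t *: r) - phi q0 - c * t.
pose G1 (t : R) := \sum_i r 0 i * partial i phi (q0 + t *: r) - c.
have dG' : \forall t \near (0 : R), is_derive (t : R) 1 G (G1 t).
  apply: filterS dG => t dt; apply: is_derive_eq.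
  have sE (u v : R^o) : u *: v = u * v by [].
  by rewrite subr0 sE mulr1.
have G0 : G 0 = 0 by rewrite /G scale0r addr0 subrr mulr0 subrr.
exists G, G1; split => //; last first.
  have dM : dotp (z *m (P *m H *m P^T)) z = (r *m (H *m r^T)) 0 0.
    transitivity ((z *m (P *m H *m P^T) *m z^T) 0 0).
      by rewrite [RHS]mxE; apply: eq_bigr => i _; congr (_ * _); rewrite [RHS]mxE.
    by rewrite /r trmx_mul !mulmxA.
  apply: is_derive_eq; rewrite subr0 dM [RHS]mxE; apply: eq_bigr => i _.
  congr (_ * _); rewrite [RHS]mxE.
  by apply: eq_bigr => j _; rewrite mulrC; congr (_ * _); rewrite [RHS]mxE.
have cG : G t @[t --> (0 : R)] --> 0.
  have [dg _] := nbhs_singleton dG'.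
  by rewrite -[X in _ --> X]G0; apply: differentiable_continuous; apply/derivable1_diffP.
have nU : \forall t \near (0 : R), U (y + t *: z + G t *: (delta_mx 0 i0 *m Q^T)).
  have ct : (y + t *: z + G t *: (delta_mx 0 i0 *m Q^T)) @[t --> (0 : R)] --> y.
    rewrite [X in _ --> X](_ : y = y + 0 *: z + 0 *: (delta_mx 0 i0 *m Q^T)); last first.
      by rewrite !scale0r !addr0.
    apply: cvgD; last exact: cvgZr_tmp.
    by apply: cvgD; [exact: cvg_cst|apply: cvgZr_tmp; exact: cvg_id].
  by apply: ct; exact: (open_nbhs_nbhs (conj oU Uy)).
apply: filterS nU => t /chart[_ /iffRL]; apply.
rewrite !mulmxDl -!scalemxAl -mulmxA QQ' mulmx1.
have -> : col' i0 (y *m Q + t *: (z *m Q) + G t *: delta_mx 0 i0) = q0 + t *: r.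
  apply/rowP => j; rewrite /q0 /r -!col'E !mxE eqxx/=.
  by rewrite eq_sym (negbTE (neq_lift _ _)) mulr0 addr0.
have mE (A B : 'rV[R]_n) : (A + B) 0 i0 = A 0 i0 + B 0 i0 by rewrite mxE.
have sE a (A : 'rV[R]_n) : (a *: A) 0 i0 = a * A 0 i0 by rewrite mxE.
have dE : (delta_mx 0 i0 : 'rV[R]_n) 0 i0 = 1 by rewrite mxE !eqxx.
rewrite !mE !sE dE mulr1 /G -/c yphi; ring.
Qed.

End boundary_curves.

(** * Geometry at a near point *)

Section euclidean_calculus.
Context {R : realType} {n : nat}.
Local Notation E := 'rV[R]_n.
Implicit Types (u v z : E).

Lemma continuous_dotp u : continuous (fun z => dotp z u).
Proof.
apply: (enorm_lipschitz_continuous (C := enorm u)) => z z'.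
rewrite -dotpBl mulrC ler_norml dotp_le andbT lerNl -dotpNl.
by rewrite -enormN dotp_le.
Qed.

Lemma is_derive_dotp (c : R -> E) (t : R) v u :
  is_derive (t : R^o) 1 c v -> is_derive (t : R) 1 (fun s : R => dotp (c s) u) (dotp v u).
Proof.
move=> /is_derive1P cv; apply/is_derive1P.
rewrite (_ : (fun h => _) = (fun z => dotp z u) \o
    (fun h : R => h^-1 *: (c (t + h) - c t))); last first.
  by apply/funext => h /=; rewrite dotpZl dotpBl.
by apply: (cvg_comp _ _ cv); exact: continuous_dotp.
Qed.

(** The vectors [nu] and [v i] are the rows of an orthogonal matrix, and the expansion of [eta] in
    these rows has only its [nu] term. *)
Lemma orthonormal_complement (v : 'I_n.-1 -> E) (nu eta : E) :
  (forall i j, dotp (v i) (v j) = (i == j)%:R) -> dotp nu nu = 1 ->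
  (forall i, dotp nu (v i) = 0) -> (forall i, dotp eta (v i) = 0) ->
  eta = dotp eta nu *: nu.
Proof.
case: n v nu eta => [|m] v nu eta vv nunu nuv etav.
  by apply/rowP => -[].
pose B : 'M[R]_m.+1 := \matrix_(i, j) (if unlift ord0 i is Some k then v k else nu) 0 j.
have rowB i : row i B = if unlift ord0 i is Some k then v k else nu.
  by apply/rowP => j; rewrite !mxE.
have dotE (a : 'rV[R]_m.+1) i : (a *m B^T) 0 i = dotp a (row i B).
  by rewrite mxE; apply: eq_bigr => j _; rewrite !mxE.
have BB : B *m B^T = 1%:M.
  apply/matrixP => i j.
  have -> : (B *m B^T) i j = dotp (row i B) (row j B).
    by rewrite mxE; apply: eq_bigr => l _; rewrite !mxE.
  rewrite !rowB mxE.
  case: (unliftP ord0 i) => [k ->|->]; case: (unliftP ord0 j) => [l ->|->].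
  - by rewrite vv (inj_eq lift_inj).
  - by rewrite dotpC nuv.
  - by rewrite nuv.
  - by rewrite nunu eqxx.
have BB' : B^T *m B = 1%:M by apply: mulmx1C.
rewrite -{1}(mulmx1 eta) -BB' mulmxA mulmx_sum_row big_ord_recl big1 ?addr0.
  by rewrite dotE rowB unlift_none.
by move=> i _; rewrite dotE rowB liftK etav scale0r.
Qed.

End euclidean_calculus.

Lemma near_point_normal {R : realType} {n : nat} (Omega : set 'rV[R]_n) x y :
  open Omega -> Omega x -> near_points Omega x y ->
  exists nu, x = y + delta Omega x *: nu /\ dotp nu nu = 1.
Proof.
move=> oO Ox [by_ yx]; have C0 : ~` Omega !=set0 by exists y; exact: bdry_notin.
have d0 := delta_gt0 oO C0 Ox.
exists ((delta Omega x)^-1 *: (x - y)); split.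
  by rewrite scalerA divff ?gt_eqF// scale1r subrKC.
rewrite dotpZl dotpZr -enorm_sqr enormB yx; field.
by rewrite gt_eqF.
Qed.

Section near_point_geometry.
Context {R : realType} {n : nat}.
Local Notation E := 'rV[R]_n.
Variables (Omega : set E) (x y : E).
Hypotheses (oO : open Omega) (cO : convex_set Omega).
Hypotheses (Ox : Omega x) (ny : near_points Omega x y).
Local Notation d := (delta Omega).

Variable nu : E.
Hypothesis near_pointE : x = y + d x *: nu.
Hypothesis nu_unit : dotp nu nu = 1.

Let by_ : bdry Omega y. Proof. exact: ny.1. Qed.
Let nOy : ~ Omega y. Proof. exact: bdry_notin. Qed.
Let C0 : ~` Omega !=set0. Proof. by exists y. Qed.
Let d0 : 0 < d x. Proof. exact: delta_gt0. Qed.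

(** If [z - y] pointed to the negative side, a small step from [y] away from [z] would enter the
    ball of radius [d x] about [x], hence [Omega]. Then [y] would lie between two points of
    [Omega]. *)
Lemma supporting z : Omega z -> 0 <= dotp (z - y) nu.
Proof.
move=> Oz; rewrite leNgt; apply/negP => zy; apply: nOy.
have [w we] : exists w, w = z - y by exists (z - y).
rewrite -we in zy; have [a ae] : exists a, a = dotp w nu by exists (dotp w nu).
rewrite -ae in zy.
have [N Ne] : exists N, N = dotp w w by exists (dotp w w).
have N0 : 0 < N.
  rewrite Ne lt_neqAle dotp_ge0 andbT eq_sym; apply/eqP => /dotp_eq0 z0.
  by move: zy; rewrite ae z0 dotp0l ltxx.
(* With [s N = - a d], the squared distance [d^2 + 2 s d a + s^2 N] to [x] collapses to
   [d^2 + s d a], which is below [d^2] as [a < 0]. *)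
have [s [s0 sN]] : exists s, 0 < s /\ s * N = - a * d x.
  exists (- a * d x / N); split; last by rewrite divfK ?gt_eqF.
  by rewrite divr_gt0// mulr_gt0// oppr_gt0.
have Op : Omega (y - s *: w).
  apply: (@delta_ball _ _ _ C0 x).
  rewrite -(@ltr_pXn2r _ 2)// ?nnegrE ?enorm_ge0 ?ltW// enorm_sqr.
  rewrite (_ : x - _ = d x *: nu + s *: w); last first.
    by rewrite {1}near_pointE opprD opprK addrACA subrr add0r.
  rewrite !(dotpDl, dotpDr, dotpZl, dotpZr) nu_unit (dotpC nu) -ae -Ne sN.
  rewrite (_ : _ + _ = d x ^+ 2 + s * (d x * a)); last by ring.
  by rewrite gtrDl pmulr_rlt0// pmulr_rlt0.
rewrite we in Op.
have s1 : 0 < 1 + s by rewrite addr_gt0.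
have -> : y = (1 + s)^-1 *: (y - s *: (z - y)) + (1 - (1 + s)^-1) *: z.
  by apply/rowP => i; rewrite !mxE; field; rewrite gt_eqF.
apply: convex_comb => //; first by rewrite invr_ge0 ltW.
by rewrite invf_le1// lerDl ltW.
Qed.

Lemma supporting_bdry z : bdry Omega z -> 0 <= dotp (z - y) nu.
Proof.
move=> [cz _]; rewrite leNgt; apply/negP => zy.
have [w [Ow /= wz]] := cz _ (nbhs_enorm_ball z (r := - dotp (z - y) nu) (ltac:(by rewrite oppr_gt0))).
have := supporting Ow; rewrite -(subrK z w) -addrA dotpDl => h.
have := dotp_le (w - z) nu.
have -> : enorm nu = 1 by rewrite /enorm nu_unit sqrtr1.
by move=> h'; lra.
Qed.

(** Along a curve on the boundary, the supporting half-space makes [dotp (c s) nu] minimal at [y],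
    so its derivative vanishes there. *)
Lemma tangent_nu v : tangent (bdry Omega) y v -> dotp nu v = 0.
Proof.
move=> [c [c0 cb dc]]; rewrite dotpC.
apply: (@is_derive_min R (fun s => dotp (c s) nu)); first exact: is_derive_dotp.
apply: filterS cb => t /supporting_bdry; rewrite dotpBl c0; lra.
Qed.

Lemma inward_normal_nu : inward_normal Omega y nu.
Proof.
split; first by rewrite /enorm nu_unit sqrtr1.
  by move=> v; exact: tangent_nu.
exists (2 * d x); first by rewrite /= mulr_gt0.
move=> t /=; rewrite sub0r normrN => td t0.
apply: (@delta_ball _ _ _ C0 x); rewrite {1}near_pointE.
rewrite opprD addrACA subrr add0r -scalerBl enormZ /enorm nu_unit sqrtr1 mulr1.
rewrite gtr0_norm// in td.
by rewrite ltr_norml; apply/andP; split; lra.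
Qed.

Variable kappa : 'I_n.-1 -> R.
Variable v : 'I_n.-1 -> E.
Hypothesis vv : forall i j, dotp (v i) (v j) = (i == j)%:R.
Hypothesis dv : forall i, derive_along (bdry Omega) (normal_field Omega) y (v i) (kappa i *: v i).

Lemma nu_v i : dotp nu (v i) = 0.
Proof. by apply: tangent_nu; exact: (dv i).1. Qed.

(** The field is defined by choice, but any inward normal is orthogonal to all [v i], hence [nu] or
    [- nu]. The latter would make [y] the midpoint of two points of [Omega]. *)
Lemma normal_field_nu : normal_field Omega y = nu.
Proof.
have [e1 etav e_in] : inward_normal Omega y (normal_field Omega y).
  by apply: getPex; exists nu; exact: inward_normal_nu.
set eta := normal_field Omega y in e1 etav e_in *.
have [c eE] : exists c, eta = c *: nu.
  by exists (dotp eta nu); exact: orthonormal_complement vv nu_unit nu_v (fun i => etav _ (dv i).1).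
have : c ^+ 2 = 1.
  have : dotp eta eta = 1 by rewrite -enorm_sqr e1 expr1n.
  by rewrite eE dotpZl dotpZr nu_unit mulr1.
move=> /eqP; rewrite sqrf_eq1 => /orP[/eqP c1|/eqP c1]; first by rewrite eE c1 scale1r.
have [_ _ nu_in] := inward_normal_nu.
have [t [Ot1 Ot2]] : exists t, Omega (y + t *: eta) /\ Omega (y + t *: nu).
  apply: (@filter_ex _ (0 : R)^'+ _
    (fun t => Omega (y + t *: eta) /\ Omega (y + t *: nu))).
  exact: filterI e_in nu_in.
exfalso; apply: nOy.
have := convex_comb cO (t := 2^-1) (ltac:(lra)) (ltac:(lra)) Ot1 Ot2.
rewrite {1}eE c1 scaleN1r scalerN (_ : 1 - 2^-1 = 2^-1 :> R); last by lra.
rewrite -scalerDr addrACA addNr addr0 -{1 2}(scale1r y) -scalerDl scalerA.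
by rewrite mulVf// scale1r.
Qed.

(** * Second-order geometry along the boundary curves of a chart *)

Section chart.
Variables (Ev : E) (M : 'M[R]_n).
Hypothesis chart : forall z, exists G G1 : R -> R,
    [/\ G 0 = 0, \forall t \near (0 : R), bdry Omega (y + t *: z + G t *: Ev),
        \forall t \near (0 : R), is_derive (t : R) 1 G (G1 t) &
        is_derive (0 : R) 1 G1 (dotp (z *m M) z)].

Lemma is_derive_curve (z : E) (G : R -> R) (t g : R) : is_derive (t : R) 1 G g ->
  is_derive (t : R^o) 1 (fun t : R => y + t *: z + G t *: Ev) (z + g *: Ev).
Proof.
move=> /is_derive1P dG; apply/is_derive1P.
have : (z + (h^-1 *: (G (t + h) - G t)) *: Ev) @[h --> 0^'] --> z + g *: Ev.
  by apply: cvgD; [exact: cvg_cst|exact: cvgZr_tmp].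
apply: cvg_trans; apply: near_eq_cvg; exists 1 => //= h _ h0.
have sE (a b : R^o) : a *: b = a * b by [].
by apply/rowP => i; rewrite !mxE sE; field.
Qed.

(** Tangency is needed at all boundary points of the curve near [y], since orthogonality to the
    normal field will be differentiated along it. *)
Lemma tangent_curve (z : E) (G G1 : R -> R) :
  (\forall t \near (0 : R), bdry Omega (y + t *: z + G t *: Ev)) ->
  (\forall t \near (0 : R), is_derive (t : R) 1 G (G1 t)) ->
  \forall t \near (0 : R),
    tangent (bdry Omega) (y + t *: z + G t *: Ev) (z + G1 t *: Ev).
Proof.
move=> /near_join gb dG; near=> t.
exists (fun s => y + (t + s) *: z + G (t + s) *: Ev); split.
- by rewrite addr0.
- have : \forall s \near t, bdry Omega (y + s *: z + G s *: Ev) by near: t.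
  move=> [r /= r0 hr]; exists r => // s /=; rewrite sub0r normrN => sr.
  by apply: hr; rewrite /= opprD addrA subrr sub0r normrN.
- have /(is_derive_curve z)/is_derive1P dg : is_derive (t : R) 1 G (G1 t) by near: t.
  apply/is_derive1P; apply: (cvg_trans _ dg); apply: near_eq_cvg.
  by apply: nearW => h /=; rewrite add0r addr0.
Unshelve. all: by end_near. Qed.

(** The chart axis is transversal to the boundary: otherwise the curve in direction [nu] would have
    a velocity with normal component 1. *)
Lemma nu_Ev : dotp nu Ev != 0.
Proof.
have [G [G1 [G0 gb dG _]]] := chart nu.
have := tangent_nu (ltac:(
  by have := nbhs_singleton (tangent_curve gb dG); rewrite G0 scale0r scale0r !addr0) :
  tangent (bdry Omega) y (nu + G1 0 *: Ev)).
rewrite dotpDr nu_unit dotpZr => h; apply/eqP => e0; move: h; rewrite e0; lra.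
Qed.

Lemma chart_orthogonal z : dotp nu z = 0 -> exists G G1 : R -> R,
  [/\ G 0 = 0, \forall t \near (0 : R), bdry Omega (y + t *: z + G t *: Ev),
      \forall t \near (0 : R), is_derive (t : R) 1 G (G1 t), G1 0 = 0 &
      is_derive (0 : R) 1 G1 (dotp (z *m M) z)].
Proof.
move=> nuz; have [G [G1 [G0 gb dG dG1]]] := chart z; exists G, G1; split => //.
have := tangent_nu (ltac:(
  by have := nbhs_singleton (tangent_curve gb dG); rewrite G0 scale0r scale0r !addr0) :
  tangent (bdry Omega) y (z + G1 0 *: Ev)).
rewrite dotpDr nuz add0r dotpZr => /eqP; rewrite mulf_eq0 (negbTE nu_Ev) orbF.
by move=> /eqP.
Qed.

Lemma chart_cvg (G G1 : R -> R) b : G 0 = 0 -> G1 0 = 0 ->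
  (\forall t \near (0 : R), is_derive (t : R) 1 G (G1 t)) ->
  is_derive (0 : R) 1 G1 b -> G t / t ^+ 2 @[t --> 0^'] --> b / 2.
Proof.
move=> G0 G10 dG dG1; have := peano_taylor2 dG dG1.
by rewrite G0 G10; under eq_fun do rewrite mulr0 !subr0.
Qed.

(* Differentiates [normal . gam' = 0] at [0].  Where no inward normal exists, [normal_field]
   is 0, which its continuity along [gam] excludes near [0]. *)
Lemma curvatureE i : kappa i = - (dotp (v i *m M) (v i) * dotp nu Ev).
Proof.
have [G [G1 [G0 gb dG G10 dG1]]] := chart_orthogonal (nu_v i).
pose gam (t : R) := y + t *: v i + G t *: Ev.
have gam0 : gam 0 = y by rewrite /gam G0 !scale0r !addr0.
have dgam : is_derive (0 : R^o) 1 gam (v i).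
  by have := is_derive_curve (v i) (nbhs_singleton dG); rewrite G10 scale0r addr0.
have dN : is_derive (0 : R^o) 1 (normal_field Omega \o gam) (kappa i *: v i).
  by apply: (dv i).2; split.
have cN : dotp ((normal_field Omega \o gam) t) nu @[t --> (0 : R)] --> (1 : R).
  have [dN1 _] := is_derive_dotp nu dN.
  rewrite -[X in _ --> X]nu_unit -[X in dotp X _]normal_field_nu -gam0.
  apply: (@differentiable_continuous _ _ _ (0 : R)
    (fun t => dotp ((normal_field Omega \o gam) t) nu)).
  exact/derivable1_diffP.
have Npos : \forall t \near (0 : R), 0 < dotp ((normal_field Omega \o gam) t) nu.
  by move/cvgrPdist_lt : cN => /(_ 1 ltr01); apply: filterS => t; rewrite ltr_norml => /andP[_]; lra.
pose F (t : R) := dotp ((normal_field Omega \o gam) t) (v i) +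
                  G1 t * dotp ((normal_field Omega \o gam) t) Ev.
have F0 : \forall t \near (0 : R), F t = 0.
  apply: filterS2 (tangent_curve gb dG) Npos => t tt tpos.
  have : exists eta, inward_normal Omega (gam t) eta.
    apply: contrapT => /forallNP h; move: tpos.
    rewrite /= /normal_field getPN// (_ : point = 0) ?dotp0l ?ltxx//.
    by apply/rowP => j; rewrite !mxE.
  move=> /getPex[_ /(_ _ tt)].
  by rewrite dotpDr dotpZr.
have dF : is_derive (0 : R) 1 F (kappa i + dotp (v i *m M) (v i) * dotp nu Ev).
  have dNv := is_derive_dotp (v i) dN; have dNE := is_derive_dotp Ev dN.
  have -> : F = (fun t : R => dotp ((normal_field Omega \o gam) t) (v i)) +
    (G1 * (fun t : R => dotp ((normal_field Omega \o gam) t) Ev)) by [].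
  apply: is_derive_eq.
  have sE (a b : R^o) : a *: b = a * b by [].
  rewrite !sE G10 mul0r add0r /= gam0 normal_field_nu dotpZl vv eqxx mulr1.
  by rewrite [X in _ + X]mulrC.
have : is_derive (0 : R) 1 F 0.
  have h0 : is_derive (0 : R) 1 (cst 0 : R -> R) 0 by exact: is_derive_cst.
  by apply: (near_eq_is_derive _ h0); apply: filterS F0 => t ->.
move=> [_ e1]; have [_ e2] := dF; move: e1; rewrite e2; lra.
Qed.

(** The normal component of the curve is [G t * dotp nu Ev], nonnegative by the supporting
    half-space; dividing by [t^2] and passing to the limit gives the sign. *)
Lemma chart_convex z : dotp nu z = 0 -> 0 <= dotp (z *m M) z * dotp nu Ev.
Proof.
move=> nuz; have [G [G1 [G0 gb dG G10 dG1]]] := chart_orthogonal nuz.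
have cG := chart_cvg G0 G10 dG dG1.
rewrite leNgt; apply/negP => neg.
have cGE : (G t / t ^+ 2 * dotp nu Ev) @[t --> 0^'] --> dotp (z *m M) z / 2 * dotp nu Ev.
  by apply: cvgM => //; exact: cvg_cst.
have : dotp (z *m M) z / 2 * dotp nu Ev < 0.
  by rewrite mulrAC pmulr_llt0 ?invr_gt0.
move=> /(cvgr_lt _ cGE).
move=> /(filterI (nbhs_dnbhs gb))/filter_ex[t [/supporting_bdry]].
have -> : y + t *: z + G t *: Ev - y = t *: z + G t *: Ev.
  by apply/rowP => i; rewrite !mxE; ring.
rewrite dotpDl !dotpZl (dotpC z) nuz mulr0 add0r (dotpC Ev) => h; apply/negP; rewrite -leNgt.
by rewrite mulrAC mulr_ge0// invr_ge0 sqr_ge0.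
Qed.

Lemma kappa_le0 i : kappa i <= 0.
Proof. by rewrite curvatureE oppr_le0 chart_convex// nu_v. Qed.

(** Replaces the square root by a quadratic expression, with equality for [s = enorm u]. Inserting
    for [s] the first-order expansion of the distance therefore loses nothing at second order. *)
Lemma enorm_le_AMGM (u : E) s : 0 < s -> enorm u <= (dotp u u + s ^+ 2) / (2 * s).
Proof.
move=> s0; rewrite ler_pdivlMr ?mulr_gt0// -enorm_sqr.
by have := sqr_ge0 (enorm u - s); nra.
Qed.

(** While [x] moves by [t e], the competing boundary point moves from [y] with velocity [w]. The
    distance between them is estimated by [enorm_le_AMGM] with [s = d x + t * dotp nu e]. *)
Lemma delta_upper_chart (e w : E) : dotp e e = 1 -> dotp nu w = 0 ->
  exists Rf : R -> R,
   Rf t @[t --> 0^'] --> (dotp (e - w) (e - w) - dotp nu e ^+ 2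
      - d x * (dotp (w *m M) w * dotp nu Ev)) / (2 * d x) /\
   \forall t \near 0^', d (x + t *: e) <= d x + t * dotp nu e + t ^+ 2 * Rf t.
Proof.
move=> ee nuw; have [G [G1 [G0 gb dG G10 dG1]]] := chart_orthogonal nuw.
have cG := chart_cvg G0 G10 dG dG1.
set b := dotp (w *m M) w in cG *; set l := dotp nu Ev; set a := dotp nu e.
set q := dotp (e - w) (e - w); pose m := dotp (e - w) Ev.
pose pi t := G t / t ^+ 2.
(* This is the squared distance minus [s^2], divided by [t^2]; in the limit [pi t] tends to [b / 2]
   and [t * pi t] to 0. *)
pose Rn t := q - a ^+ 2 - 2 * d x * l * pi t - 2 * m * (t * pi t)
   + dotp Ev Ev * ((t * pi t) * (t * pi t)).
exists (fun t => Rn t / (2 * (d x + t * a))).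
have ct : t @[t --> (0 : R)^'] --> (0 : R) by exact: (@nbhs_dnbhs _ (0 : R)).
have ctpi : (t * pi t) @[t --> 0^'] --> 0 by rewrite -[X in _ --> X](mul0r (b / 2)); exact: cvgM.
have cs : (d x + t * a) @[t --> 0^'] --> d x.
  rewrite -[X in _ --> X]addr0 -[X in _ --> _ + X](mul0r a); apply: cvgD; first exact: cvg_cst.
  by apply: cvgM => //; exact: cvg_cst.
split.
  apply: cvgM; last first.
    by apply: cvgV; [rewrite mulf_neq0 ?gt_eqF|apply: cvgM => //; exact: cvg_cst].
  rewrite (_ : _ - d x * (b * l) = q - a ^+ 2 - 2 * d x * l * (b / 2) - 2 * m * 0 + dotp Ev Ev * (0 * 0)); last by field.
  apply: cvgD; last by apply: cvgM; [exact: cvg_cst|exact: cvgM].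
  apply: cvgB; last by apply: cvgM => //; exact: cvg_cst.
  by apply: cvgB; [exact: cvg_cst|apply: cvgM => //; exact: cvg_cst].
have spos : \forall t \near 0^', 0 < d x + t * a by exact: (cvgr_gt _ cs).
near=> t.
have t0 : t != 0 by near: t; exact: nbhs_dnbhs_neq.
have s0 : 0 < d x + t * a by near: t.
have Gt : bdry Omega (y + t *: w + G t *: Ev) by near: t; exact: nbhs_dnbhs.
apply: le_trans (delta_le C0 _ (bdry_notin oO Gt)) _.
apply: le_trans (enorm_le_AMGM _ s0) _.
have -> : x + t *: e - (y + t *: w + G t *: Ev) = d x *: nu + t *: (e - w) - G t *: Ev.
  by rewrite {1}near_pointE; apply/rowP => i; rewrite !mxE; ring.
have nuew : dotp nu (e - w) = a by rewrite dotpBr nuw subr0.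
have GE : G t = pi t * t ^+ 2 by rewrite /pi divfK// expf_neq0.
move: nuew; rewrite /Rn /m /q; move: (e - w) => f nuf.
rewrite !(dotpDl, dotpDr, dotpNl, dotpNr, dotpZl, dotpZr) nu_unit.
rewrite (dotpC f nu) nuf (dotpC Ev nu) (dotpC Ev f) -/l GE.
rewrite le_eqVlt; apply/orP; left; apply/eqP; field.
by rewrite gt_eqF.
Unshelve. all: by end_near. Qed.

(** The velocity [w j] is the image of [e j] under the operator with [v i -> A i v i] and [nu -> 0].
    Summing over the standard basis produces traces, which are evaluated in the basis of principal
    directions by orthonormality. *)
Lemma second_diff_lower_chart (A : 'I_n.-1 -> R) (lo : R) :
  lo < - (\sum_i ((1 - A i) ^+ 2 + d x * kappa i * A i ^+ 2) / d x) ->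
  \forall t \near 0^', lo <= second_diff d t x.
Proof.
move=> hlo.
pose e (j : 'I_n) : E := delta_mx 0 j.
pose w (j : 'I_n) : E := \sum_i (A i * v i 0 j) *: v i.
pose c (j : 'I_n) := (dotp (e j - w j) (e j - w j) - dotp nu (e j) ^+ 2
      - d x * (dotp (w j *m M) (w j) * dotp nu Ev)) / (2 * d x).
have ee j : dotp (e j) (e j) = 1 by rewrite dotp_delta mxE !eqxx.
have nuw j : dotp nu (w j) = 0.
  by rewrite dotp_sumr big1// => i _; rewrite dotpZr nu_v mulr0.
have sumc : \sum_j c j = (\sum_i ((1 - A i) ^+ 2 + d x * kappa i * A i ^+ 2) / d x) / 2.
  have quad (N : 'M[R]_n) : \sum_j dotp (w j *m N) (w j) = \sum_i A i ^+ 2 * dotp (v i *m N) (v i).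
    have -> : \sum_j dotp (w j *m N) (w j) = \sum_j \sum_i \sum_k
        A i * A k * dotp (v i *m N) (v k) * (v i 0 j * v k 0 j).
      apply: eq_bigr => j _; rewrite mulmx_suml dotp_suml; apply: eq_bigr => i _.
      rewrite dotp_sumr; apply: eq_bigr => k _.
      by rewrite -scalemxAl dotpZl dotpZr; ring.
    rewrite exchange_big; apply: eq_bigr => i _; rewrite exchange_big (bigD1 i)//=.
    rewrite -mulr_sumr -/(dotp _ _) vv eqxx mulr1 big1 => [|k /negbTE ki].
      by rewrite addr0 expr2.
    by rewrite -mulr_sumr -/(dotp _ _) vv eq_sym ki mulr0.
  have wjj : \sum_j w j 0 j = \sum_i A i.
    have -> : \sum_j w j 0 j = \sum_j \sum_i A i * (v i 0 j * v i 0 j).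
      apply: eq_bigr => j _; rewrite summxE; apply: eq_bigr => i _.
      by rewrite mxE mulrA.
    rewrite exchange_big; apply: eq_bigr => i _.
    by rewrite -mulr_sumr -/(dotp _ _) vv eqxx mulr1.
  have qw : \sum_j dotp (w j) (w j) = \sum_i A i ^+ 2.
    have := quad 1%:M; under eq_bigr do rewrite mulmx1; move=> ->.
    by apply: eq_bigr => i _; rewrite mulmx1 vv eqxx mulr1.
  have qM : (\sum_j dotp (w j *m M) (w j)) * dotp nu Ev = - \sum_i kappa i * A i ^+ 2.
    rewrite quad mulr_suml -sumrN; apply: eq_bigr => i _; rewrite curvatureE; ring.
  (* The existence of the unit vector [nu] excludes dimension 0. *)
  have n0 : (n%:R : R) = n.-1%:R + 1.
    rewrite natr1 prednK// lt0n; apply/eqP => n0; have := nu_unit.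
    rewrite /dotp big1 => [/eqP|i]; first by rewrite eq_sym oner_eq0.
    by have := ltn_ord i; rewrite {2}n0.
  have sD : \sum_j dotp (e j - w j) (e j - w j) = n%:R - 2 * (\sum_i A i) + \sum_i A i ^+ 2.
    have -> : \sum_j dotp (e j - w j) (e j - w j) =
        \sum_j (1 - 2 * w j 0 j + dotp (w j) (w j)).
      apply: eq_bigr => j _; rewrite dotpBl !dotpBr ee (dotpC (e j)) !dotp_delta; ring.
    by rewrite big_split big_split/= sumr_const card_ord sumrN -mulr_sumr wjj qw.
  have sA : \sum_i ((1 - A i) ^+ 2 + d x * kappa i * A i ^+ 2) =
      n.-1%:R - 2 * (\sum_i A i) + \sum_i A i ^+ 2 + d x * \sum_i kappa i * A i ^+ 2.
    have -> : \sum_i ((1 - A i) ^+ 2 + d x * kappa i * A i ^+ 2) =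
        \sum_i (1 - 2 * A i + A i ^+ 2 + d x * (kappa i * A i ^+ 2)).
      by apply: eq_bigr => i _; ring.
    by rewrite !big_split/= sumr_const card_ord sumrN -!mulr_sumr.
  have snu : \sum_j dotp nu (e j) ^+ 2 = 1.
    by rewrite -[RHS]nu_unit; apply: eq_bigr => j _; rewrite dotp_delta expr2.
  rewrite -mulr_suml sA -mulr_suml !big_split/= !sumrN sD snu -mulr_sumr -mulr_suml qM n0.
  by field; rewrite gt_eqF.
have /choice[Rp hRp] := fun j => delta_upper_chart (ee j) (nuw j).
(* The backward step uses [- e j] and [- w j]; [c j] is quadratic in this pair, so the limit is the
   same. *)
have /choice[Rm hRm] : forall j, exists Rf : R -> R, Rf t @[t --> 0^'] --> c j /\
    \forall t \near 0^', d (x - t *: e j) <= d x - t * dotp nu (e j) + t ^+ 2 * Rf t.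
  move=> j; have [||Rf [h1 h2]] := @delta_upper_chart (- e j) (- w j).
  - by rewrite dotpNl dotpNr opprK.
  - by rewrite dotpNr nuw oppr0.
  exists Rf; split.
    move: h1; rewrite -opprD dotpNl !dotpNr opprK sqrrN mulNmx dotpNl opprK.
    exact.
  apply: filterS h2 => t; rewrite scalerN dotpNr mulrN; exact.
have cS : (- \sum_j (Rp j t + Rm j t)) @[t --> 0^'] --> - \sum_j (c j + c j).
  apply: cvgN; apply: cvg_sumr => j; apply: cvgD; first exact: (hRp j).1.
  exact: (hRm j).1.
have hlo' : lo < - \sum_j (c j + c j).
  by rewrite big_split/= sumc -splitr.
have /(cvgr_gt _ cS) hS := hlo'.
have hp : \forall t \near 0^', forall j, d (x + t *: e j) <= d x + t * dotp nu (e j) + t ^+ 2 * Rp j t.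
  by apply: filter_forall => j; exact: (hRp j).2.
have hm : \forall t \near 0^', forall j, d (x - t *: e j) <= d x - t * dotp nu (e j) + t ^+ 2 * Rm j t.
  by apply: filter_forall => j; exact: (hRm j).2.
near=> t.
have t0 : t != 0 by near: t; exact: nbhs_dnbhs_neq.
have /ltW h1 : lo < - \sum_j (Rp j t + Rm j t) by near: t.
have h2 : forall j, d (x + t *: e j) <= d x + t * dotp nu (e j) + t ^+ 2 * Rp j t by near: t; exact: hp.
have h3 : forall j, d (x - t *: e j) <= d x - t * dotp nu (e j) + t ^+ 2 * Rm j t by near: t; exact: hm.
apply: (le_trans h1); rewrite -sumrN; apply: ler_sum => j _.
rewrite ler_pdivlMr; last by rewrite exprn_even_gt0.
have := h2 j; have := h3 j; rewrite /e; lra.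
Unshelve. all: by end_near. Qed.

End chart.
End near_point_geometry.

(** * Points with bounded second differences *)

Section regular_points.
Context {R : realType} {n : nat}.
Local Notation E := 'rV[R]_n.
Local Notation e i := (delta_mx 0 i : E).
Variables (Omega : set E).
Hypotheses (oO : open Omega) (cO : convex_set Omega) (C0 : ~` Omega !=set0).
Local Notation d := (delta Omega).

Lemma delta_second_diff_ge0 x i (h : R) : Omega x -> `|h| < d x ->
  0 <= 2 * d x - d (x + h *: e i) - d (x - h *: e i).
Proof.
move=> Ox hd.
have O1 : Omega (x + h *: e i).
  by apply: (@delta_ball _ _ _ C0 x); rewrite opprD addNKr enormN enormZ enorm_delta mulr1.
have O2 : Omega (x - h *: e i).
  by apply: (@delta_ball _ _ _ C0 x); rewrite opprD opprK addNKr enormZ enorm_delta mulr1.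
have := delta_concave oO cO C0 (t := 2^-1) (ltac:(lra)) (ltac:(lra)) O1 O2.
rewrite (_ : 2^-1 *: _ + _ = x); last by apply/rowP => j; rewrite !mxE; field.
by lra.
Qed.

Variables (x y nu : E).
Hypotheses (Ox : Omega x) (ny : near_points Omega x y).
Hypotheses (near_pointE : x = y + d x *: nu) (nu_unit : dotp nu nu = 1).

Let d0 : 0 < d x. Proof. exact: delta_gt0. Qed.

(** Here the boundary point stays at [y]. The condition [|t| <= d x / 2] keeps [d x + t nu_i] above
    [d x / 2], which gives the constant [1 / d x]. *)
Lemma delta_upper_coord i (t : R) : `|t| <= d x / 2 ->
  d (x + t *: e i) <= d x + t * nu 0 i + t ^+ 2 / d x.
Proof.
move=> td.
have nu1 : `|nu 0 i| <= 1.
  by rewrite (le_trans (coord_le_enorm _ _))// /enorm nu_unit sqrtr1.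
have s0 : d x / 2 <= d x + t * nu 0 i.
  have : `|t * nu 0 i| <= d x / 2.
    by rewrite normrM (le_trans _ td)// ler_piMr.
  by rewrite ler_norml => /andP[]; lra.
have s0' : 0 < d x + t * nu 0 i by rewrite (lt_le_trans _ s0)// divr_gt0.
apply: le_trans (delta_le C0 _ (bdry_notin oO ny.1)) _.
apply: le_trans (enorm_le_AMGM _ s0') _.
rewrite (_ : _ - y = d x *: nu + t *: e i); last first.
  by rewrite {1}near_pointE addrAC (addrAC y) subrr add0r.
rewrite !(dotpDl, dotpDr, dotpZl, dotpZr) nu_unit (dotpC (e i) nu) !dotp_delta mxE !eqxx /=.
rewrite ler_pdivrMr ?mulr_gt0//; set a := nu 0 i in nu1 s0 s0' *.
rewrite (_ : _ + _ = (d x + t * a) ^+ 2 + t ^+ 2 * (1 - a ^+ 2) + (d x + t * a) ^+ 2); last by ring.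
have h1 : t ^+ 2 * (1 - a ^+ 2) <= t ^+ 2.
  by rewrite ler_piMr ?sqr_ge0// gerBl sqr_ge0.
have h2 : t ^+ 2 <= t ^+ 2 / d x * (2 * (d x + t * a)).
  rewrite -mulrA ler_peMr ?sqr_ge0// mulrC ler_pdivlMr//; lra.
by nra.
Qed.

Variable C : R.
Hypothesis freq : forall rho, 0 < rho -> exists h, [/\ 0 < h, h < rho & second_diff d h x <= C].

(** At one small step [h] with second difference at most [C], the upper bound on one side gives a
    lower bound on the other, with error [C' h^2]. Concavity between [x] and the points [x + h e_i],
    [x - h e_i] spreads it to all [|t| < h] with error [C' h |t|], and [C' h <= eps]. *)
Lemma delta_cvg_coord i : (d (x + t *: e i) - d x) / t @[t --> 0^'] --> nu 0 i.
Proof.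
pose C' := `|C| + (d x)^-1.
have C'0 : 0 < C' by rewrite ltr_wpDl// invr_gt0.
apply/cvgrPdist_le => eps eps0.
have [|h [h0 hrho sd]] := freq (rho := Num.min (d x / 2) (eps / C')).
  by rewrite lt_min !divr_gt0.
move: hrho; rewrite lt_min => /andP[hd heps].
have hh : 0 < h ^+ 2 by rewrite exprn_gt0.
have hC : C' * h <= eps by rewrite mulrC -ler_pdivlMr// ltW.
have sdi : 2 * d x - d (x + h *: e i) - d (x - h *: e i) <= C * h ^+ 2.
  rewrite -ler_pdivrMr//; apply: le_trans sd.
  rewrite /second_diff (bigD1 i)//= lerDl; apply: sumr_ge0 => j _.
  rewrite divr_ge0 ?(ltW hh)// delta_second_diff_ge0// gtr0_norm//; lra.
have Ch : C * h ^+ 2 <= `|C| * h ^+ 2 by rewrite ler_pM2r// ler_norm.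
have up (s : R) : `|s| <= h -> d (x + s *: e i) <= d x + s * nu 0 i + s ^+ 2 / d x.
  by move=> sh; apply: delta_upper_coord; lra.
have hn : `|h| <= h by rewrite gtr0_norm.
have lowp : d x + h * nu 0 i - C' * h ^+ 2 <= d (x + h *: e i).
  have := up (- h); rewrite normrN => /(_ hn); rewrite scaleNr sqrrN mulNr /C' mulrDl.
  rewrite [_^-1 * _]mulrC; lra.
have lowm : d x - h * nu 0 i - C' * h ^+ 2 <= d (x - h *: e i).
  have := up h hn; rewrite /C' mulrDl [_^-1 * _]mulrC; lra.
have Op : Omega (x + h *: e i).
  by apply: (@delta_ball _ _ _ C0 x); rewrite opprD addNKr enormN enormZ enorm_delta mulr1 gtr0_norm//; lra.
have Om : Omega (x - h *: e i).
  by apply: (@delta_ball _ _ _ C0 x); rewrite opprD opprK addNKr enormZ enorm_delta mulr1 gtr0_norm//; lra.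
exists h => // t /=; rewrite sub0r normrN => th t0.
have tp : 0 < `|t| by rewrite normr_gt0.
pose lam := `|t| / h.
have lam0 : 0 <= lam by rewrite divr_ge0// ltW.
have lam1 : lam <= 1 by rewrite ler_pdivrMr// mul1r ltW.
have lamh : lam * h = `|t| by rewrite divfK ?gt_eqF.
have low : d x + t * nu 0 i - C' * h * `|t| <= d (x + t *: e i).
  have [tpos|tneg] := leP 0 t.
    have := delta_concave oO cO C0 lam0 lam1 Op Ox.
    have -> : lam *: (x + h *: e i) + (1 - lam) *: x = x + t *: e i.
      have : lam * h = t by rewrite lamh ger0_norm.
      by move=> <-; apply/rowP => j; rewrite !mxE; ring.
    apply: le_trans; have := ler_wpM2l lam0 lowp; rewrite -lamh.
    have : t = lam * h by rewrite lamh ger0_norm.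
    move=> ->; nra.
  have := delta_concave oO cO C0 lam0 lam1 Om Ox.
  have te : t = - (lam * h) by rewrite lamh ltr0_norm// opprK.
  have -> : lam *: (x - h *: e i) + (1 - lam) *: x = x + t *: e i.
    by rewrite te; apply/rowP => j; rewrite !mxE; ring.
  apply: le_trans; have := ler_wpM2l lam0 lowm; rewrite -lamh te; nra.
have upt := up t (ltW th).
have t2 : t ^+ 2 / d x <= C' * h * `|t|.
  rewrite -real_normK ?num_real// expr2 mulrAC ler_pM2r// mulrC.
  by apply: ler_pM => //; [rewrite invr_ge0 ltW|rewrite /C' lerDr|exact: ltW].
have -> : nu 0 i - (d (x + t *: e i) - d x) / t = (d x + t * nu 0 i - d (x + t *: e i)) / t.
  by field.
rewrite normrM normfV ler_pdivrMr//; apply: (@le_trans _ _ (C' * h * `|t|)).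
  by rewrite ler_norml; apply/andP; split; lra.
by rewrite ler_pM2r.
Qed.

Lemma grad_delta : grad d x = nu.
Proof.
apply/rowP => i; rewrite mxE /partial /derive.
apply: cvg_lim => //; have := @delta_cvg_coord i; apply: cvg_trans.
apply: near_eq_cvg; apply: nearW => t /=.
by rewrite (addrC _ x) mulrC.
Qed.

Variable kappa : 'I_n.-1 -> R.
Hypothesis C2 : Ck_boundary 2 Omega.
Hypothesis pc : principal_curvatures Omega y kappa.

Lemma second_diff_lower (A : 'I_n.-1 -> R) (lo : R) :
  lo < - (\sum_i ((1 - A i) ^+ 2 + d x * kappa i * A i ^+ 2) / d x) ->
  \forall t \near 0^', lo <= second_diff d t x.
Proof.
have [Ev [M chart]] := boundary_chart C2 ny.1; have [v [vv dv]] := pc.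
exact: (second_diff_lower_chart oO cO Ox ny near_pointE nu_unit vv dv chart).
Qed.

Lemma curvature_le0 i : kappa i <= 0.
Proof.
have [Ev [M chart]] := boundary_chart C2 ny.1; have [v [vv dv]] := pc.
exact: (kappa_le0 oO cO Ox ny near_pointE nu_unit vv dv chart).
Qed.

Lemma second_diff_bounded_contra (lo : R) : C < lo ->
  ~ \forall t \near 0^', lo <= second_diff d t x.
Proof.
move=> Clo [rho /= rho0 hrho].
have [h [h0 hr sd]] := freq rho0.
have := hrho h; rewrite /= sub0r normrN gtr0_norm// => /(_ hr).
by rewrite gt_eqF// => /(_ isT); lra.
Qed.

(** If [1 + d kappa_i <= 0], the bound of [second_diff_lower] grows at least linearly in the speed
    [A i], contradicting second differences at most [C] at arbitrarily small steps. *)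
Lemma curvature_gt i : 0 < 1 + d x * kappa i.
Proof.
rewrite ltNge; apply/negP => ki.
(* Chosen so that [2 N - (n - 1) - 1] exceeds [(C + 1) * d x]. *)
pose N := `|C| * d x + n.-1%:R + 1 + d x.
pose A j := if j == i then N else 0.
apply: (@second_diff_bounded_contra (C + 1)); first by rewrite ltrDl.
apply: (@second_diff_lower A).
have N0 : 0 <= `|C| * d x by rewrite mulr_ge0// ltW.
have m0 : (0 : R) <= n.-1%:R by [].
have sA : \sum_j ((1 - A j) ^+ 2 + d x * kappa j * A j ^+ 2) <= n.-1%:R + 1 - 2 * N.
  rewrite (bigD1 i)//= {1 2}/A eqxx.
  have : \sum_(j | j != i) ((1 - A j) ^+ 2 + d x * kappa j * A j ^+ 2) <= n.-1%:R.
    apply: (@le_trans _ _ (\sum_(j < n.-1) 1)); last by rewrite sumr_const card_ord.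
    rewrite [leRHS](bigD1 i)//= (@le_trans _ _ (\sum_(j | j != i) 1))//; last by rewrite lerDr.
    by apply: ler_sum => j /negbTE ji; rewrite /A ji subr0 expr1n expr0n mulr0 addr0.
  have : N ^+ 2 * (1 + d x * kappa i) <= 0 by rewrite mulr_ge0_le0// sqr_ge0.
  by nra.
rewrite -mulr_suml -mulNr ltr_pdivlMr//.
have := ler_norm C => hC; have : C * d x <= `|C| * d x by rewrite ler_pM2r.
move: sA; rewrite /N; set S := \sum_j _ => sA CC.
have := d0; have := m0; lra.
Qed.

Lemma second_diff_kappa (lo : R) :
  lo < `|\sum_i kappa i / (1 + d x * kappa i)| ->
  \forall t \near 0^', lo <= second_diff d t x.
Proof.
(* These speeds maximise the concave quadratic bound. Geometrically, [1 + d kappa_i] is the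
   stretching from the boundary to the parallel surface through [x], so its inverse is the speed of
   the near point. *)
move=> hlo; apply: (@second_diff_lower (fun i => (1 + d x * kappa i)^-1)).
apply: (lt_le_trans hlo); rewrite ler0_norm; last first.
  by apply: sumr_le0 => i _; rewrite mulr_le0_ge0 ?curvature_le0// invr_ge0 ltW// curvature_gt.
rewrite lerN2; apply: ler_sum => i _.
have k0 := curvature_gt i; rewrite le_eqVlt; apply/orP; left; apply/eqP; field.
by rewrite ?(gt_eqF k0) ?(gt_eqF d0).
Qed.

End regular_points.

(** * Powers *)

Section powers.
Context {R : realType}.
Implicit Types (a b c s t p : R).

Lemma lipschitz_derive (g dg : R -> R) (C a b : R) :
  (forall t, Num.min a b <= t <= Num.max a b -> is_derive (t : R) 1 g (dg t)) ->
  (forall t, Num.min a b <= t <= Num.max a b -> `|dg t| <= C) ->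
  `|g a - g b| <= C * `|a - b|.
Proof.
wlog ab : a b / a <= b => [hw dg1 dgC|].
  have [ab|/ltW ba] := leP a b; first exact: hw.
  by rewrite distrC [in leRHS]distrC; apply: hw => // t; rewrite minC maxC => ht; [exact: dg1|exact: dgC].
rewrite min_l// max_r// => dg1 dgC.
have [||xi /itvP xab e] := @MVT_segment _ g dg a b ab.
- by move=> t /itvP tab; apply: dg1; rewrite !tab.
- by apply: derivable_within_continuous => t /itvP tab; have [] // := dg1 t; rewrite !tab.
rewrite distrC e normrM [in leRHS]distrC; apply: ler_wpM2r => //.
by apply: dgC; rewrite !xab.
Qed.

(** At 0 the difference quotient has absolute value [|h|^(p - 1)], which tends to 0 because
    [p > 1]. *)
Lemma is_derive_norm_powR p s : 1 < p ->
  is_derive (s : R) 1 (fun t : R => `|t| `^ p) (p * `|s| `^ (p - 1) * Num.sg s).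
Proof.
move=> p1; have p0 : 0 < p by lra.
have [s0|s0|<-] := ltgtP 0 s.
- rewrite gtr0_sg// mulr1 gtr0_norm//.
  apply: near_eq_is_derive (is_derive1_powR p s0).
  by near=> t; rewrite gtr0_norm//; near: t; exact: lt_nbhsr.
- have s0' : 0 < - s by rewrite oppr_gt0.
  rewrite ltr0_sg// mulrN1 ltr0_norm//.
  have dN : is_derive (s : R) 1 (fun t : R => - t) (-1) by apply: is_derive_eq.
  have := @is_derive1_comp R (fun u : R => u `^ p) (fun t : R => - t) s _ _ (is_derive1_powR p s0') dN.
  rewrite mulrN1; apply: near_eq_is_derive.
  by near=> t; rewrite /= ltr0_norm//; near: t; exact: lt_nbhsl.
- rewrite sgr0 mulr0; apply/is_derive1P.
  apply/cvgrPdist_le => eps eps0.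
  exists (eps `^ (p - 1)^-1) => /=; first exact: powR_gt0.
  move=> h /=; rewrite sub0r normrN => he h0.
  have hp : 0 < `|h| by rewrite normr_gt0.
  rewrite sub0r add0r normr0 powR0 ?gt_eqF// subr0 normrN.
  rewrite normrM normfV [X in _ * X]ger0_norm ?powR_ge0//.
  have -> : `|h|^-1 * `|h| `^ p = `|h| `^ (p - 1).
    by rewrite -(@mulr_powRB1 _ `|h| p)// mulKf// gt_eqF.
  have -> : eps = (eps `^ (p - 1)^-1) `^ (p - 1).
    by rewrite -powRrM mulVf ?powRr1 ?ltW// gt_eqF// subr_gt0.
  by apply: ge0_ler_powR; rewrite ?nnegrE ?powR_ge0 ?subr_ge0 ?ltW.
Unshelve. all: by end_near. Qed.

Lemma powR_gt0_le a b c : 0 <= c -> 0 < a -> a <= b -> b `^ (- c) <= a `^ (- c).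
Proof.
move=> c0 a0 ab; have b0 : 0 < b by apply: lt_le_trans ab.
rewrite !powRN lef_pV2 ?posrE ?powR_gt0//.
by apply: ge0_ler_powR => //; rewrite nnegrE ltW.
Qed.

Lemma young_powR a b p : 0 <= a -> 0 <= b -> 1 < p ->
  p * (a * b `^ (p - 1)) <= a `^ p + (p - 1) * b `^ p.
Proof.
move=> a0 b0 p1; have p0 : 0 < p by lra.
have q0 : 0 < p / (p - 1) by rewrite divr_gt0// subr_gt0.
have pne : p != 0 by rewrite gt_eqF.
have p1ne : p - 1 != 0 by rewrite gt_eqF// subr_gt0.
have := @conjugate_powR R a (b `^ (p - 1)) p (p / (p - 1)) a0 (powR_ge0 _ _) p0 q0.
have -> : p^-1 + (p / (p - 1))^-1 = 1 by field; rewrite pne p1ne.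
move=> /(_ erefl); rewrite -powRrM (_ : (p - 1) * (p / (p - 1)) = p); last by field.
move=> h; have := ler_wpM2l (ltW p0) h.
rewrite (_ : p * (_ / p + _) = a `^ p + (p - 1) * b `^ p)//.
by field; rewrite pne p1ne.
Qed.

(* With [c = (p - 1) / p], Young's inequality for [X / c] and [W ^ (p - 1)]. *)
Lemma young_hardy p (X W Lam : R) : 1 < p -> 0 <= X -> 0 <= W ->
  Lam <= p * (X * W `^ (p - 1)) - (p - 1) * W `^ p ->
  ((p - 1) / p) `^ p * (W `^ p + p / (p - 1) * Lam) <= X `^ p.
Proof.
move=> p1 X0 W0 hL; have p0 : 0 < p by lra.
have p1' : 0 < p - 1 by rewrite subr_gt0.
set c := (p - 1) / p; have c0 : 0 < c by rewrite divr_gt0.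
have -> : X `^ p = c `^ p * (X / c) `^ p.
  have cX : c * (X / c) = X by rewrite mulrC divfK// gt_eqF.
  by rewrite -powRM ?cX//; [exact: ltW|apply: divr_ge0 => //; exact: ltW].
apply: ler_wpM2l; first exact: powR_ge0.
have := @young_powR (X / c) W p (divr_ge0 X0 (ltW c0)) W0 p1.
have := ler_wpM2l (ltW (divr_gt0 p0 p1')) hL.
rewrite mulrBr (_ : p / (p - 1) * (p * _) = p * (X / c * W `^ (p - 1))); last first.
  by rewrite /c; field; rewrite !gt_eqF.
rewrite (_ : p / (p - 1) * ((p - 1) * _) = p * W `^ p); last by field; rewrite gt_eqF.
lra.
Qed.

End powers.

(** * Test functions *)

Lemma norm_le_between {R : realType} (a b t M : R) : `|a| <= M -> `|b| <= M ->
  Num.min a b <= t -> t <= Num.max a b -> `|t| <= M.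
Proof.
rewrite ge_min le_max !ler_norml => /andP[a1 a2] /andP[b1 b2].
by move=> /orP[h1|h1] /orP[h2|h2]; apply/andP; split; lra.
Qed.

Section test_function.
Context {R : realType} {n : nat}.
Local Notation E := 'rV[R]_n.
Local Notation e i := (delta_mx 0 i : E).
Variables (Omega : set E) (f : E -> R).
Hypothesis hf : smooth_compact_support Omega f.
Let K := closure [set x | f x != 0].

Lemma test_continuous : continuous f.
Proof. by have [Ckf _ _] := hf; have [cf _] := Ckf 0%N => x; apply: cf. Qed.

Lemma test_partial_continuous i : continuous (partial i f).
Proof.
have [Ckf _ _] := hf; have [_ /(_ i)[_ [cf _]]] := Ckf 1%N.
by move=> x; apply: cf.
Qed.

Lemma test_is_derive x i (s : R) :
  is_derive (s : R) 1 (fun t : R => f (x + t *: e i)) (partial i f (x + s *: e i)).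
Proof.
have [Ckf _ _] := hf; have [_ C1] := Ckf 1%N.
apply: (@is_derive_coord_line R n setT f (fun i => partial i f)) => //.
by move=> z j _; apply: (C1 j).1.
Qed.

Lemma test_neq0 x : f x != 0 -> Omega x.
Proof. by have [_ _ KO] := hf => fx; apply: KO; exact: subset_closure. Qed.

Lemma test_supp_in : exists N, supp_in N f /\ forall i, supp_in N (partial i f).
Proof.
have [_ cK _] := hf; have [M [_ hM]] := compact_bounded cK.
have M1 : M < `|M| + 1 by rewrite (le_lt_trans (ler_norm _))// ltrDl.
have KN x i : K x -> `|x 0 i| <= `|M| + 1.
  move=> /(hM _ M1); apply: le_trans.
  by rewrite [leRHS]/Num.norm/= mx_normrE; apply/bigmax_geP; right; exists (0, i).
exists (`|M| + 1); split=> [x fx j|i x px j]; apply: KN; first exact: subset_closure.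
apply: contrapT => nKx; move: px; apply/negP; rewrite negbK; apply/eqP.
rewrite /partial; transitivity ('D_(e i) (cst 0 : E -> R) x); last exact: derive_cst.
apply: near_eq_derive.
have : nbhs x (~` K).
  by apply: open_nbhs_nbhs; split => //; apply: closed_openC; exact: closed_closure.
apply: (@filterS _ _ (nbhs_filter x)) => z /= nKz.
by apply/eqP; apply: contra_notT nKz => fz; exact: (@subset_closure _ [set x | f x != 0]).
Qed.

Lemma supp_in_norm_le (g : E -> R) N : continuous g -> supp_in N g ->
  exists2 C, 0 <= C & forall x, `|g x| <= C.
Proof.
move=> cg sg; have [C C0 hC] := supp_in_bounded cg sg.
exists C => // x; have := hC [tuple x 0 i | i < n].
have -> : row_of_tuple [tuple x 0 i | i < n] = x.
  by apply/rowP => i; rewrite mxE tnth_mktuple.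
move=> h; apply: (le_trans h); rewrite indicE.
by case: (_ \in _); rewrite ?mulr1 ?mulr0.
Qed.

Lemma test_lipschitz : exists2 C, 0 <= C &
  forall x i (h : R), `|f (x + h *: e i) - f x| <= C * `|h|.
Proof.
have [N [_ sN]] := test_supp_in.
have /choice[C hC] : forall i, exists C, 0 <= C /\ forall x, `|partial i f x| <= C.
  move=> i; have [C C0 hC] := supp_in_norm_le (@test_partial_continuous i) (sN i).
  by exists C.
exists (\sum_i C i) => [|x i h]; first by apply: sumr_ge0 => i _; exact: (hC i).1.
have [t ht|xi _] := @mean_value R (fun t => f (x + t *: e i)) (fun t => partial i f (x + t *: e i)) h.
  exact: test_is_derive.
rewrite scale0r addr0 => ->; rewrite normrM ler_wpM2r//.
rewrite (le_trans ((hC i).2 _))// (bigD1 i)//= lerDl.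
by apply: sumr_ge0 => j _; exact: (hC j).1.
Qed.

(** [delta] attains a positive minimum on the compact support. The factor 2 leaves room for steps up
    to [r] inside [Omega] and keeps truncation at [r] inactive near points with [f != 0]. *)
Lemma test_delta_ge : open Omega -> ~` Omega !=set0 ->
  exists2 r, 0 < r & forall x, f x != 0 -> 2 * r <= delta Omega x.
Proof.
move=> oO C0; have [_ cK KO] := hf.
have [[z Kz]|K0] := pselect (K !=set0); last first.
  by exists 1 => // x fx; exfalso; apply: K0; exists x; exact: subset_closure.
have [c /set_mem Kc hc] := EVT_min_rV (ex_intro _ z Kz) cK
  (continuous_subspaceT (continuous_delta C0)).
have dc := delta_gt0 oO C0 (KO _ Kc).
exists (delta Omega c / 2); first by rewrite divr_gt0.
move=> x fx; rewrite mulrC divfK//; apply: hc; apply/mem_set.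
exact: subset_closure.
Qed.

End test_function.

Section weighted_test_function.
Context {R : realType} {n : nat}.
Local Notation E := 'rV[R]_n.
Local Notation e i := (delta_mx 0 i : E).
Variables (p : R) (Omega : set E) (f : E -> R) (r : R).
Hypotheses (p1 : 1 < p) (oO : open Omega) (C0 : ~` Omega !=set0).
Hypothesis hf : smooth_compact_support Omega f.
Hypotheses (r0 : 0 < r) (hr : forall x, f x != 0 -> 2 * r <= delta Omega x).
Local Notation d := (delta Omega).

(* Truncation makes negative powers globally Lipschitz and changes nothing where [f != 0]. *)
Definition trunc_delta (x : E) : R := Num.max (d x) r.

(** The value [a = p - 1] gives the test weight, [a = p] the Hardy weight [|f|^p / delta^p]. *)
Definition weighted (a : R) (x : E) : R := `|f x| `^ p * trunc_delta x `^ (- a).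

Lemma trunc_delta_ge x : r <= trunc_delta x.
Proof. by rewrite le_max lexx orbT. Qed.

Lemma trunc_delta_gt0 x : 0 < trunc_delta x.
Proof. exact: lt_le_trans (trunc_delta_ge x). Qed.

Lemma trunc_deltaE x : r <= d x -> trunc_delta x = d x.
Proof. by move=> rd; rewrite /trunc_delta max_l. Qed.

Lemma trunc_delta_supp x : f x != 0 -> trunc_delta x = d x.
Proof. by move=> /hr rd; apply: trunc_deltaE; move: rd r0; lra. Qed.

Lemma trunc_delta_lipschitz x y : `|trunc_delta x - trunc_delta y| <= enorm (x - y).
Proof.
apply: le_trans (delta_lipschitz C0 x y); rewrite /trunc_delta.
have [h1|h1] := leP (d x) r; have [h2|h2] := leP (d y) r => //.
- by rewrite subrr normr0.
- by rewrite distrC [leRHS]distrC !ger0_norm; lra.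
- by rewrite !ger0_norm; lra.
Qed.

Lemma continuous_norm_powR : continuous (fun x => `|f x| `^ p).
Proof.
move=> x; apply: (@continuous_comp _ _ _ f (fun t : R => `|t| `^ p)).
  exact: test_continuous hf x.
apply: differentiable_continuous; apply/derivable1_diffP.
by have [] := is_derive_norm_powR (f x) p1.
Qed.

Lemma continuous_trunc_powR a : continuous (fun x => trunc_delta x `^ a).
Proof.
move=> x; apply: (@continuous_comp _ _ _ trunc_delta (fun t : R => t `^ a)).
  apply: (enorm_lipschitz_continuous (C := 1)) => y z; rewrite mul1r.
  exact: trunc_delta_lipschitz.
apply: differentiable_continuous; apply/derivable1_diffP.
by have [] := is_derive1_powR a (trunc_delta_gt0 x).
Qed.

Lemma continuous_weighted a : continuous (weighted a).
Proof.
move=> x; apply: (@continuousM _ E (fun x => `|f x| `^ p)).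
  exact: continuous_norm_powR.
exact: continuous_trunc_powR.
Qed.

Lemma weighted_ge0 a x : 0 <= weighted a x.
Proof. by rewrite mulr_ge0 ?powR_ge0. Qed.

Lemma weighted_eq0 a x : f x = 0 -> weighted a x = 0.
Proof.
move=> fx; have p0 : p != 0 by rewrite gt_eqF// (lt_trans ltr01).
by rewrite /weighted fx normr0 powR0// mul0r.
Qed.

Lemma weighted_gt0 a x : f x != 0 -> 0 < weighted a x.
Proof. by move=> fx; rewrite mulr_gt0 ?powR_gt0 ?normr_gt0 ?trunc_delta_gt0. Qed.

Lemma supp_in_weighted N a : supp_in N f -> supp_in N (weighted a).
Proof.
by move=> sN x wx; apply: sN; apply: contraNneq wx => /weighted_eq0 ->.
Qed.

Lemma weighted_lipschitz a : 0 <= a -> exists C, forall x i (h : R),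
  `|weighted a (x + h *: e i) - weighted a x| <= C * `|h|.
Proof.
move=> a0; have [N [sN _]] := test_supp_in hf.
have [M M0 fM] := supp_in_norm_le (test_continuous hf) sN.
have [Cf Cf0 fl] := test_lipschitz hf.
pose C1 := p * M `^ (p - 1); pose C2 := a * r `^ (- (a + 1)).
have p0 : 0 < p by exact: lt_trans p1.
have C10 : 0 <= C1 by rewrite mulr_ge0 ?powR_ge0 ?ltW.
exists (C1 * Cf * r `^ (- a) + M `^ p * C2) => x i h; rewrite /weighted.
set F1 := `|f (x + _)| `^ p; set F0 := `|f x| `^ p.
set D1 := trunc_delta (x + _) `^ _; set D0 := trunc_delta x `^ _.
have -> : F1 * D1 - F0 * D0 = (F1 - F0) * D1 + F0 * (D1 - D0) by ring.
rewrite (le_trans (ler_normD _ _))// !normrM mulrDl lerD//.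
  rewrite mulrAC ler_pM//.
    rewrite (le_trans (lipschitz_derive (C := C1) (fun t _ => is_derive_norm_powR t p1) _))//.
      move=> t /andP[t1 t2]; rewrite normrM -[leRHS]mulr1; apply: ler_pM => //.
        rewrite normrM (ger0_norm (ltW p0)) ler_wpM2l ?(ltW p0)// ger0_norm ?powR_ge0//.
        apply: ge0_ler_powR; rewrite ?nnegrE// ?subr_ge0 ?(ltW p1)//.
        exact: (norm_le_between (fM (x + h *: e i)) (fM x) t1 t2).
      by rewrite normr_sg; case: (_ != 0).
    by rewrite -(mulrA C1) ler_wpM2l// fl.
  by rewrite ger0_norm ?powR_ge0// powR_gt0_le// trunc_delta_ge.
rewrite -mulrA ler_pM//.
  rewrite ger0_norm ?powR_ge0//; apply: ge0_ler_powR; rewrite ?nnegrE// ?(ltW p0)//.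
have mpos t : Num.min (trunc_delta (x + h *: e i)) (trunc_delta x) <= t -> r <= t.
  by apply: le_trans; rewrite le_min !trunc_delta_ge.
rewrite (le_trans (lipschitz_derive (C := C2) (g := fun t => t `^ (- a)) (dg := fun t => - a * t `^ (- a - 1)) _ _))//.
- move=> t /andP[/mpos rt _]; apply: is_derive1_powR; exact: lt_le_trans rt.
- move=> t /andP[/mpos rt _]; rewrite normrM normrN (ger0_norm a0) ler_wpM2l//.
  by rewrite ger0_norm ?powR_ge0// -opprD powR_gt0_le// addr_ge0.
- rewrite ler_wpM2l ?mulr_ge0 ?powR_ge0//.
  rewrite (le_trans (trunc_delta_lipschitz _ _))// addrAC subrr add0r enormZ enorm_delta mulr1.
  exact: lexx.
Qed.

End weighted_test_function.

(** * Pointwise limits *)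

Section pointwise_limits.
Context {R : realType} {n : nat}.
Local Notation E := 'rV[R]_n.
Local Notation e i := (delta_mx 0 i : E).

Lemma is_derive_quotient (g : E -> R) x i (D : R) :
  is_derive (0 : R) 1 (fun t : R => g (x + t *: e i)) D <->
  (g (x + t *: e i) - g x) / t @[t --> 0^'] --> D.
Proof.
have -> : (fun t : R => (g (x + t *: e i) - g x) / t) =
    (fun t : R => t^-1 *: (g (x + (0 + t) *: e i) - g (x + 0 *: e i))).
  by apply/funext => t; rewrite add0r scale0r addr0 mulrC.
by split => [/is_derive1P|h]; [|apply/is_derive1P].
Qed.

Lemma step_dnbhs0 (r : R) (h : R -> R) (l : R) : 0 < r ->
  h t @[t --> 0^'] --> l -> h (step r k) @[k --> \oo] --> l.
Proof.
move=> r0 /cvgr_dnbhsP; apply; split; last exact: step_cvg0.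
by move=> k; rewrite gt_eqF// step_gt0.
Qed.

Variables (p : R) (Omega : set E) (f : E -> R) (r : R).
Hypotheses (p1 : 1 < p) (oO : open Omega) (C0 : ~` Omega !=set0).
Hypothesis hf : smooth_compact_support Omega f.
Hypotheses (r0 : 0 < r) (hr : forall x, f x != 0 -> 2 * r <= delta Omega x).
Local Notation d := (delta Omega).
Local Notation psi := (weighted p Omega f r (p - 1)).

Lemma is_derive_test_powR x i :
  is_derive (0 : R) 1 (fun t : R => `|f (x + t *: e i)| `^ p)
    (p * `|f x| `^ (p - 1) * Num.sg (f x) * partial i f x).
Proof.
have := test_is_derive hf x i 0; have := is_derive_norm_powR (f x) p1.
rewrite -[in X in X -> _](addr0 x) -[in X in X -> _](scale0r (e i)) => d1 d2.
have := @is_derive1_comp R (fun t : R => `|t| `^ p) (fun t : R => f (x + t *: e i)) 0 _ _ d1 d2.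
by rewrite scale0r addr0.
Qed.

(** Differentiability of [d] is unknown at such a point, but its quotient is bounded by 1 and the
    truncated power by [r^(- (p - 1))], while [|f|^p] has derivative 0. *)
Lemma grad_diff_cvg0 x : f x = 0 -> grad_diff psi d (step r k) x @[k --> \oo] --> 0.
Proof.
move=> fx; rewrite [X in _ --> X](_ : 0 = \sum_(i < n) 0); last by rewrite big1.
apply: cvg_sumr => i.
have : (`|f (x + t *: e i)| `^ p - `|f x| `^ p) / t @[t --> 0^'] --> 0.
  apply/(is_derive_quotient (fun x => `|f x| `^ p)).
  by have := is_derive_test_powR x i; rewrite fx sgr0 mulr0 mul0r.
move=> /(step_dnbhs0 r0)/cvgrPdist_lt hc; apply/cvgrPdist_lt => eps eps0.
pose B := r `^ (- (p - 1)).
have B0 : 0 < B by rewrite powR_gt0.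
apply: filterS (hc _ (divr_gt0 eps0 B0)) => k; rewrite !sub0r !normrN.
have h0 := step_gt0 r0 k; set h := step r k in h0 *.
rewrite ltr_pdivlMr// fx normr0 powR0 ?subr0; last by rewrite gt_eqF// (lt_trans ltr01).
move=> hk; rewrite (weighted_eq0 _ _ p1 _ fx) subr0 /weighted.
have d1 : `|(d (x + h *: e i) - d x) / h| <= 1.
  rewrite normrM normfV (gtr0_norm h0) ler_pdivrMr// mul1r.
  rewrite (le_trans (delta_lipschitz C0 _ _))// addrAC subrr add0r enormZ enorm_delta mulr1.
  by rewrite gtr0_norm.
have m1 : `|trunc_delta Omega r (x + h *: e i) `^ (- (p - 1))| <= B.
  rewrite ger0_norm ?powR_ge0// powR_gt0_le// ?trunc_delta_ge//.
  by rewrite subr_ge0 ltW.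
move: hk m1 d1; set F := `|f _| `^ p; set m := trunc_delta _ _ _ `^ _; set q := (d _ - d _) / h.
move=> hk m1 d1; apply: le_lt_trans hk.
rewrite (_ : F * m / h * q = F / h * (m * q)); last by ring.
rewrite normrM ler_wpM2l// normrM -[leRHS]mulr1.
by apply: ler_pM.
Qed.

Lemma grad_diff_cvg x (nu : E) : f x != 0 ->
  (forall i, (d (x + t *: e i) - d x) / t @[t --> 0^'] --> nu 0 i) ->
  grad_diff psi d (step r k) x @[k --> \oo] -->
   p * `|f x| `^ (p - 1) * Num.sg (f x) * d x `^ (- (p - 1)) * dotp nu (grad f x)
   - (p - 1) * (`|f x| `^ p * d x `^ (- p)) * dotp nu nu.
Proof.
move=> fx dq.
have rd : r < d x by apply: lt_le_trans (hr fx); rewrite ltr_pMl// ltr1n.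
have dd i : is_derive (0 : R) 1 (fun t : R => trunc_delta Omega r (x + t *: e i)) (nu 0 i).
  have := dq i; move=> /is_derive_quotient; apply: near_eq_is_derive.
  exists (d x - r); first by rewrite /= subr_gt0.
  move=> t /=; rewrite sub0r normrN => td; rewrite trunc_deltaE//.
  have := delta_lipschitz C0 (x + t *: e i) x.
  rewrite addrAC subrr add0r enormZ enorm_delta mulr1 ler_norml => /andP[h1 h2].
  by lra.
have dx0 : 0 < d x by apply: lt_trans rd.
have tdx : trunc_delta Omega r x = d x by rewrite trunc_deltaE// ltW.
have dm i : is_derive (0 : R) 1 (fun t : R => trunc_delta Omega r (x + t *: e i) `^ (- (p - 1)))
    (- (p - 1) * d x `^ (- p) * nu 0 i).
  have pw : is_derive (trunc_delta Omega r (x + 0 *: e i)) 1 (fun u : R => u `^ (- (p - 1)))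
      (- (p - 1) * d x `^ (- p)).
    rewrite scale0r addr0 tdx; have := is_derive1_powR (- (p - 1)) dx0.
    by rewrite (_ : - (p - 1) - 1 = - p); last by ring.
  exact: (@is_derive1_comp R (fun u : R => u `^ (- (p - 1)))
    (fun t : R => trunc_delta Omega r (x + t *: e i)) 0 _ _ pw (dd i)).
have dpsi i : (psi (x + t *: e i) - psi x) / t @[t --> 0^'] -->
    p * `|f x| `^ (p - 1) * Num.sg (f x) * partial i f x * d x `^ (- (p - 1))
    - (p - 1) * (`|f x| `^ p * d x `^ (- p)) * nu 0 i.
  apply/is_derive_quotient.
  have df := is_derive_test_powR x i; have dmi := dm i.
  have -> : (fun t : R => psi (x + t *: e i)) =
    (fun t : R => `|f (x + t *: e i)| `^ p) *
    (fun t : R => trunc_delta Omega r (x + t *: e i) `^ (- (p - 1))) by [].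
  apply: is_derive_eq.
  have sE (u v : R^o) : u *: v = u * v by [].
  rewrite !sE scale0r addr0 tdx; ring.
rewrite [X in _ --> X](_ : _ = \sum_i (p * `|f x| `^ (p - 1) * Num.sg (f x) * partial i f x * d x `^ (- (p - 1))
    - (p - 1) * (`|f x| `^ p * d x `^ (- p)) * nu 0 i) * nu 0 i); last first.
  rewrite /dotp !mulr_sumr -sumrB; apply: eq_bigr => i _; rewrite mxE; ring.
apply: cvg_sumr => i; apply: cvgM.
  exact: (step_dnbhs0 (h := fun t => (psi (x + t *: e i) - psi x) / t) r0 (dpsi i)).
exact: (step_dnbhs0 (h := fun t => (d (x + t *: e i) - d x) / t) r0 (dq i)).
Qed.

End pointwise_limits.

(** * The inequality *)

Section hardy_inequality.
Context {R : realType} {n : nat}.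
Local Notation E := 'rV[R]_n.
Local Notation e i := (delta_mx 0 i : E).
Local Notation mu := (@lebesgue_Rn R n).
Local Notation rot := (@row_of_tuple R n).
Variables (p : R) (Omega : set E) (kappa : E -> 'I_n.-1 -> R) (f : E -> R) (r : R).
Hypotheses (p1 : 1 < p) (oO : open Omega) (cO : convex_set Omega) (C0 : ~` Omega !=set0).
Hypothesis C2 : Ck_boundary 2 Omega.
Hypothesis pc : forall y, bdry Omega y -> principal_curvatures Omega y (kappa y).
Hypothesis hf : smooth_compact_support Omega f.
Hypotheses (r0 : 0 < r) (hr : forall x, f x != 0 -> 2 * r <= delta Omega x).
Local Notation d := (delta Omega).
Local Notation psi := (weighted p Omega f r (p - 1)).
Local Notation w := (weighted p Omega f r p).

Let Lpsi (x : E) : \bar R :=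
  limn_einf (fun k => (psi x * second_diff d (step r k) x)%:E).

Lemma weighted_second_diff_ge0 x h : 0 < h -> h <= r -> 0 <= psi x * second_diff d h x.
Proof.
move=> h0 hr'; have [fx|fx] := eqVneq (f x) 0; first by rewrite weighted_eq0// mul0r.
have dx := hr fx; apply: mulr_ge0; first exact: weighted_ge0.
apply: sumr_ge0 => i _; rewrite divr_ge0 ?sqr_ge0//.
apply: (delta_second_diff_ge0 oO cO C0 i (test_neq0 hf fx)).
by rewrite gtr0_norm//; move: r0 => r0'; lra.
Qed.

Lemma Lpsi_nneg x : (0 <= Lpsi x)%E.
Proof.
apply: le_limn_einf; apply: nearW => k; rewrite lee_fin.
by rewrite weighted_second_diff_ge0 ?step_gt0 ?step_le.
Qed.

(** A finite lower limit is undercut by 1 more than its value infinitely often; dividing by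
    [psi x > 0] yields bounded second differences along some steps only, which is all that the
    pointwise analysis requires. *)
Lemma second_diff_freq x : (Lpsi x < +oo)%E -> f x != 0 ->
  exists C, forall rho, 0 < rho -> exists h, [/\ 0 < h, h < rho & second_diff d h x <= C].
Proof.
move=> Lx fx; have psi0 := weighted_gt0 p Omega r0 (p - 1) fx.
have Lfin : Lpsi x \is a fin_num by rewrite ge0_fin_numE ?Lpsi_nneg.
pose c := fine (Lpsi x) + 1.
have Lc : (Lpsi x < c%:E)%E by rewrite -(fineK Lfin) lte_fin ltrDl.
exists (c / psi x) => rho rho0.
have /cvgrPdist_lt/(_ _ rho0)[N _ hN] := @step_cvg0 R r.
have [k Nk] := limn_einf_lt Lc N; rewrite lte_fin => hk.
exists (step r k); split; first exact: step_gt0.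
  by have := hN _ Nk; rewrite /= sub0r normrN gtr0_norm// step_gt0.
by rewrite ler_pdivlMr// mulrC ltW.
Qed.

Lemma near_point_near x : Omega x -> near_points Omega x (near_point Omega x).
Proof. by move=> Ox; apply: getPex; exact: near_point_exists. Qed.

(* [grad psi . grad delta], once [|grad delta| = 1]. *)
Definition weak_limit (x : E) : R :=
  p * `|f x| `^ (p - 1) * Num.sg (f x) * d x `^ (- (p - 1)) * dotp (grad d x) (grad f x)
   - (p - 1) * (`|f x| `^ p * d x `^ (- p)).

Lemma weak_limit_eq0 x : f x = 0 -> weak_limit x = 0.
Proof.
move=> fx; have pne : p != 0 by rewrite gt_eqF// (lt_trans ltr01).
by rewrite /weak_limit fx sgr0 mulr0 !mul0r normr0 powR0// mul0r mulr0 subr0.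
Qed.

Lemma grad_diff_weak_limit x : (Lpsi x < +oo)%E ->
  grad_diff psi d (step r k) x @[k --> \oo] --> weak_limit x.
Proof.
move=> Lx; have [fx|fx] := eqVneq (f x) 0.
  by rewrite weak_limit_eq0//; exact: (@grad_diff_cvg0 R n p Omega f r p1 C0 hf r0).
have Ox := test_neq0 hf fx; have ny := near_point_near Ox.
have [nu [xE nunu]] := near_point_normal oO Ox ny.
have [C freq] := second_diff_freq Lx fx.
have dq i := delta_cvg_coord oO cO C0 Ox ny xE nunu freq i.
have := @grad_diff_cvg R n p Omega f r p1 C0 hf r0 hr x nu fx dq.
by rewrite nunu mulr1 /weak_limit (grad_delta oO cO C0 Ox ny xE nunu freq).
Qed.

(** The pointwise bound holds at every near point, in particular at the chosen one, but only for
    levels strictly below the absolute curvature sum, whence the loss of [eps / psi x]. *)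
Lemma weighted_kappa_tilde x : (Lpsi x < +oo)%E -> f x != 0 ->
  ((psi x * `|kappa_tilde Omega kappa x|)%:E <= Lpsi x)%E.
Proof.
move=> Lx fx; have psi0 := weighted_gt0 p Omega r0 (p - 1) fx.
have Ox := test_neq0 hf fx; have ny := near_point_near Ox.
have [nu [xE nunu]] := near_point_normal oO Ox ny.
have [C freq] := second_diff_freq Lx fx.
apply/lee_addgt0Pr => eps eps0; rewrite -leeBlDr//.
apply: le_limn_einf.
have hlo : `|kappa_tilde Omega kappa x| - eps / psi x < `|kappa_tilde Omega kappa x|.
  by rewrite gtrBl divr_gt0.
have := second_diff_kappa oO cO C0 Ox ny xE nunu freq C2 (pc ny.1) hlo.
move=> [rho /= rho0 hrho].
have /cvgrPdist_lt/(_ _ rho0)[N _ hN] := @step_cvg0 R r.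
exists N => // k /hN hk; have h0 := step_gt0 r0 k.
have := hrho _ hk; rewrite gt_eqF// => /(_ isT) hs.
rewrite -EFinB lee_fin.
have := ler_wpM2l (ltW psi0) hs; rewrite mulrBr (mulrC _ (eps / _)) divfK ?gt_eqF//.
Qed.

(** Since [psi = d * (|f|^p / d^p)] where [f != 0], the curvature term of the integrand is exactly
    [p / (p - 1)] times [psi] times the absolute curvature sum. *)
Lemma integrand_le x : Omega x -> (Lpsi x < +oo)%E ->
  (((1 + p * d x * `|kappa_tilde Omega kappa x| / (p - 1)) * (`|f x| `^ p / d x `^ p))%:E
    <= (w x)%:E + (p / (p - 1))%:E * Lpsi x)%E.
Proof.
move=> Ox Lx; have pp : 0 < p by exact: lt_trans p1.
have p1' : 0 < p - 1 by rewrite subr_gt0.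
have [fx|fx] := eqVneq (f x) 0.
  rewrite fx normr0 powR0 ?gt_eqF// mul0r mulr0 adde_ge0//.
    by rewrite lee_fin weighted_ge0.
  by rewrite mule_ge0 ?Lpsi_nneg// lee_fin divr_ge0// ltW.
have dx : 0 < d x := delta_gt0 oO C0 Ox.
have wE : w x = `|f x| `^ p / d x `^ p by rewrite /weighted (trunc_delta_supp r0 hr)// powRN.
have psiE : psi x = d x * (`|f x| `^ p / d x `^ p).
  rewrite /weighted (trunc_delta_supp r0 hr)// powRN mulrCA; congr (_ * _).
  rewrite -(@mulr_powRB1 _ (d x) p) ?(ltW dx)// invfM mulrA divff ?mul1r// gt_eqF//.
apply: (@le_trans _ _ ((w x)%:E + (p / (p - 1))%:E * (psi x * `|kappa_tilde Omega kappa x|)%:E)%E).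
  rewrite -EFinM -EFinD lee_fin psiE wE le_eqVlt; apply/orP; left; apply/eqP; field.
  by rewrite !gt_eqF ?powR_gt0.
rewrite leeD2l// lee_wpmul2l ?weighted_kappa_tilde//.
by rewrite lee_fin divr_ge0// ltW.
Qed.

(** The pointwise form of the final estimate, with [W = |f| / d] and [X = |grad d . grad f|]. The
    right-hand side is patched by 0 outside [Omega], where [f] and with it the left-hand side
    vanish. *)
Lemma gradient_integrand_ge x :
  ((p - 1) / p) `^ p * (w x + p / (p - 1) * weak_limit x) <=
  if x \in Omega then `|dotp (grad d x) (grad f x)| `^ p else 0.
Proof.
have pp : 0 < p by exact: lt_trans p1.
have [fx|fx] := eqVneq (f x) 0.
  rewrite weak_limit_eq0// weighted_eq0// mulr0 addr0 mulr0.
  by case: ifP => // _; exact: powR_ge0.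
have Ox := test_neq0 hf fx; rewrite mem_set//.
have dx : 0 < d x := delta_gt0 oO C0 Ox.
set X := `|dotp _ _|.
pose W := `|f x| * (d x)^-1.
have dI : (d x)^-1 = d x `^ (-1) by rewrite powR_inv1 // ltW.
have WE a : W `^ a = `|f x| `^ a * d x `^ (- a).
  by rewrite /W powRM ?invr_ge0 ?(ltW dx)// dI -powRrM mulN1r.
have -> : w x = W `^ p by rewrite WE /weighted (trunc_delta_supp r0 hr).
apply: young_hardy => //; [exact: normr_ge0|by rewrite /W mulr_ge0// invr_ge0 ltW|].
rewrite !WE /weak_limit lerD2r -!mulrA ler_wpM2l ?(ltW pp)//.
rewrite [leRHS]mulrCA ler_wpM2l ?powR_ge0//.
rewrite mulrCA [leRHS]mulrC ler_wpM2l ?powR_ge0//.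
apply: (le_trans (ler_norm _)); rewrite normrM ler_piMl//.
by rewrite normr_sg; case: (_ != 0).
Qed.

Lemma convex_hardy :
  ((((p - 1) / p) `^ p)%:E *
     integral_Rn Omega (fun x =>
       (1 + p * d x * `|kappa_tilde Omega kappa x| / (p - 1)) *
       (`|f x| `^ p / d x `^ p))%R
   <= integral_Rn Omega (fun x => `|dotp (grad d x) (grad f x)| `^ p)%R)%E.
Proof.
have pp : 0 < p by exact: lt_trans p1.
have p1' : 0 < p - 1 by rewrite subr_gt0.
have [N [sN _]] := test_supp_in hf.
have cpsi : continuous psi by exact: (@continuous_weighted R n p Omega f r p1 C0 hf r0).
have cw : continuous w by exact: (@continuous_weighted R n p Omega f r p1 C0 hf r0).
have cd : continuous d by exact: continuous_delta.
have swt a : supp_in N (weighted p Omega f r a) by exact: supp_in_weighted.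
have spsi := swt (p - 1).
have [C lpsi] := weighted_lipschitz p1 C0 hf r0 (ltW p1').
have ld x i (h : R) : `|d (x + h *: e i) - d x| <= 1 * `|h|.
  rewrite (le_trans (delta_lipschitz C0 _ _))// addrAC subrr add0r.
  by rewrite enormZ enorm_delta mulr1 mul1r.
have Lae := Lpsi_ltey cpsi cd spsi r0 lpsi ld weighted_second_diff_ge0.
have mL := measurable_Lpsi r cpsi cd.
have hLam : {ae mu, forall t, grad_diff psi d (step r k) (rot t) @[k --> \oo] -->
    weak_limit (rot t)}.
  by apply: filterS Lae => t; exact: grad_diff_weak_limit.
have [Lm [iLm Lmae LLm]] := weak_laplacian_le cpsi cd spsi r0 lpsi ld weighted_second_diff_ge0 hLam.
set c := ((p - 1) / p) `^ p; have c0 : 0 <= c by exact: powR_ge0.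
set q := p / (p - 1); have q0 : 0 <= q by rewrite divr_ge0 ?ltW.
have iw := integrable_supp_in cw (swt p).
have mw : measurable_fun [set: n.-tuple (measurableTypeR R)] (fun t => (w (rot t))%:E).
  by have /integrableP[] := iw.
have w0 t : (0 <= (w (rot t))%:E)%E by rewrite lee_fin weighted_ge0.
have L0 t : (0 <= Lpsi (rot t))%E := Lpsi_nneg (rot t).
have mqL : measurable_fun [set: n.-tuple (measurableTypeR R)] (fun t => (q%:E * Lpsi (rot t))%E).
  by apply: measurable_funeM.
have le1 : (integral_Rn Omega (fun x =>
       (1 + p * d x * `|kappa_tilde Omega kappa x| / (p - 1)) *
       (`|f x| `^ p / d x `^ p))%R <=
    \int[mu]_t (w (rot t))%:E + q%:E * \int[mu]_t Lpsi (rot t))%E.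
  rewrite -ge0_integralZl// -ge0_integralD//; last by move=> t _; rewrite mule_ge0.
  apply: ae_le_integral_measurable_right.
  - move=> t; rewrite lee_fin mulr_ge0 ?divr_ge0 ?powR_ge0// addr_ge0//.
    by rewrite divr_ge0 ?(ltW p1')// !mulr_ge0 ?(ltW pp)// delta_ge0.
  - exact: emeasurable_funD.
  - by move=> t; rewrite adde_ge0// mule_ge0.
  - by apply: filterS Lae => t Lt Ot; exact: integrand_le.
pose H (t : n.-tuple (measurableTypeR R)) : \bar R :=
  ((c%:E * (w (rot t))%:E) + (c * q)%:E * Lm t)%E.
have iH : mu.-integrable setT H.
  by apply: integrableD => //; exact: integrableZl.
(* [H] can be negative, whereas the comparison with a nonmeasurable integrand needs a nonnegative
   function: its positive part still lies below the gradient integrand and has the larger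
   integral. *)
have le2 : (\int[mu]_t H^\+%E t <= integral_Rn Omega (fun x => `|dotp (grad d x) (grad f x)| `^ p)%R)%E.
  apply: ae_le_integral_measurable_left.
  - by move=> t; rewrite lee_fin powR_ge0.
  - by apply: measurable_funepos; have /integrableP[] := iH.
  - by move=> t.
  apply: filterS Lmae => t Lmt; have := gradient_integrand_ge (rot t).
  have HE : H t = (c * (w (rot t) + q * weak_limit (rot t)))%:E.
    by rewrite /H Lmt -!EFinM -EFinD; congr EFin; ring.
  rewrite funeposE HE -/c -/q patchE.
  rewrite (_ : (t \in rot @^-1` Omega) = (rot t \in Omega)); last first.
    by apply/idP/idP => /set_mem h; apply/mem_set.
  by case: ifP => _ h; rewrite ge_max !lee_fin h ?powR_ge0 ?lexx.
apply: le_trans le2; apply: (@le_trans _ _ (\int[mu]_t H t)%E); last first.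
  apply: le_integral => //; first exact: integrable_funepos.
  by move=> t _; rewrite funeposE le_max lexx.
rewrite /H integralD//; [|exact: integrableZl|exact: integrableZl].
rewrite !integralZl//.
apply: (le_trans (lee_wpmul2l _ le1)); first by rewrite lee_fin.
rewrite ge0_muleDr; [|exact: integral_ge0|by rewrite mule_ge0// integral_ge0].
rewrite leeD2l// muleA -EFinM lee_wpmul2l// lee_fin mulr_ge0//.
Qed.

End hardy_inequality.

Theorem corollary2 (R : realType) (n : nat) (hn : (2 <= n)%N)
  (p : R) (hp : 1 < p)
  (Omega : set 'rV[R]_n)
  (Omega_domain : is_domain Omega)
  (Omega_convex : convex_set Omega)
  (Omega_C2 : Ck_boundary 2 Omega)
  (ridge_closed : closed_relative_to Omega (ridge Omega))
  (S : R -> set 'rV[R]_n)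
  (S_nbhd : forall eps : R, 0 < eps ->
     [/\ open (S eps), ridge Omega `<=` S eps & S eps `<=` Omega])
  (S_smooth : forall eps : R, 0 < eps -> smooth_boundary (S eps))
  (S_decreasing : forall eps1 eps2 : R, 0 < eps1 -> eps1 <= eps2 ->
     S eps1 `<=` S eps2)
  (S_cap : ridge Omega = \bigcap_(eps in [set eps : R | 0 < eps]) S eps)
  (S_normal : \forall eps \near 0^'+, forall x eta,
     Omega x -> bdry (S eps) x -> inward_normal (S eps) x eta ->
     0 <= dotp (grad (delta Omega) x) eta)
  (laplacian_bound : forall x, Omega x -> ~ ridge Omega x ->
     delta Omega x * laplacian (delta Omega) x <= (p - 1) / p)
  (kappa : 'rV[R]_n -> 'I_n.-1 -> R)
  (kappa_curvatures : forall y, bdry Omega y ->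
     principal_curvatures Omega y (kappa y))
  (f : 'rV[R]_n -> R)
  (hf : smooth_compact_support Omega f) :
  ((((p - 1) / p) `^ p)%:E *
     integral_Rn Omega (fun x =>
       (1 + p * delta Omega x * `|kappa_tilde Omega kappa x| / (p - 1)) *
       (`|f x| `^ p / delta Omega x `^ p))%R
   <= integral_Rn Omega (fun x =>
        `|dotp (grad (delta Omega) x) (grad f x)| `^ p)%R)%E.
Proof.
have oO : open Omega by case: Omega_domain.
have [C0|C0] := pselect (~` Omega !=set0).
  have [r r0 hr] := test_delta_ge hf oO C0.
  exact: (convex_hardy hp oO Omega_convex C0 Omega_C2 kappa_curvatures hf r0 hr).
(* [delta] is the infimum of the empty set, i.e. 0, and [0 `^ p] inverts to 0 *)
have dE x : delta Omega x = 0.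
  rewrite /delta /dist_set (_ : [set _ | _ in _] = set0) ?inf0//.
  by apply/seteqP; split => // t [y Oy _]; apply: C0; exists y.
rewrite [X in (_ * X)%E](_ : _ = 0%E); last first.
  apply: integral0_eq => t Ot.
  by rewrite dE powR0 ?invr0 ?mulr0// gt_eqF// (lt_trans ltr01).
by rewrite mule0; apply: integral_ge0 => t _; rewrite lee_fin powR_ge0.
Qed.
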